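(* Let $\Bbbk$ be a field of characteristic $0$, let $Y\in M_s(\Bbbk)^g$ be a semisimple point, let $\pi:M_s(\Bbbk)^g\to[M_s(\Bbbk),Y]$ be a fixed $\mathcal{C}(Y)$-bimodule projection, and let $(f_\ell)_{\ell=0}^L$ satisfy the truncated canonical intertwining conditions $\mathrm{IC}_L(Y)$ for some $L\in\mathbb{N}\cup\{0\}$. Then there exists a unique propagation (extension to an infinite sequence) $(f_\ell)_{\ell=0}^\infty$ satisfying the canonical intertwining conditions $\mathrm{IC}(Y)$ and $$f_\ell|_{(\ker\pi)^\ell}=0\qquad\text{for } \ell>L.$$ Moreover, $\limsup_{\ell\to\infty}\sqrt[\ell]{\|f_\ell\|_{\rm cb}}<\infty$ if $\Bbbk=\mathbb{C}$.
   Context: Operations on tuples are componentwise: $SZ=(SZ_1,\dots,SZ_g)$, $ZS=(Z_1S,\dots,Z_gS)$, $[S,Z]=SZ-ZS$ for $S\in M_s(\Bbbk)$, $Z\in M_s(\Bbbk)^g$; $[M_s(\Bbbk),Y]=\{[S,Y]:S\in M_s(\Bbbk)\}\subseteq M_s(\Bbbk)^g$. $\mathcal{C}(Y)$ is the centralizer of $Y_1,\dots,Y_g$ in $M_s(\Bbbk)$; $M_s(\Bbbk)^g$ and $[M_s(\Bbbk),Y]$ are $\mathcal{C}(Y)$-bimodules in the natural way. $Y$ is semisimple if it is similar (simultaneously conjugate) to a direct sum of irreducible points, i.e. points without nontrivial common invariant subspaces; in that case $\mathcal{C}(Y)$-bimodules are semisimple, so a projection $\pi$ exists. Canonical intertwining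 conditions: a sequence $(f_\ell)_{\ell=0}^\infty$ of $\ell$-linear maps $f_\ell:(M_s(\Bbbk)^g)^\ell\to M_s(\Bbbk)$ (with $f_0\in M_s(\Bbbk)$) satisfies $\mathrm{IC}(Y)$ if $f_1([S,Y])=[S,f_0]$ and for all $\ell\ge2$, $$f_\ell([S,Y],Z^1,\dots,Z^{\ell-1})=Sf_{\ell-1}(Z^1,\dots,Z^{\ell-1})-f_{\ell-1}(SZ^1,Z^2,\dots,Z^{\ell-1}),$$ $$f_\ell(\dots,Z^j,[S,Y],Z^{j+1},\dots)=f_{\ell-1}(\dots,Z^{j-1},Z^jS,Z^{j+1},\dots)-f_{\ell-1}(\dots,Z^j,SZ^{j+1},Z^{j+2},\dots),$$ $$f_\ell(Z^1,\dots,Z^{\ell-1},[S,Y])=f_{\ell-1}(Z^1,\dots,Z^{\ell-2},Z^{\ell-1}S)-f_{\ell-1}(Z^1,\dots,Z^{\ell-1})S$$ for $1\le j\le\ell-2$ and all $S\in M_s(\Bbbk)$, $Z^j\in M_s(\Bbbk)^g$. Truncated conditions: for $L\ge1$, a sequence $(f_\ell)_{\ell=0}^L$ of $\ell$-linear maps $f_\ell:(M_s(\Bbbk)^g)^\ell\to M_s(\Bbbk)$ satisfies $\mathrm{IC}_L(Y)$ if $f_1([S,Y])=[S,f_0]$ for all $S\in M_s(\Bbbk)$, and for all $2\le\ell\le L$, $1\le j\le\ell-2$, $S\in M_s(\Bbbk)$, $Z^j\in M_s(\Bbbk)^g$, $$f_\ell([S,Y],Z^1,\dots,Z^{\ell-1})=Sf_{\ell-1}(Z^1,\dots,Z^{\ell-1})-f_{\ell-1}(SZ^1,Z^2,\dots,Z^{\ell-1}),$$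 $$f_\ell(\dots,Z^j,[S,Y],Z^{j+1},\dots)=f_{\ell-1}(\dots,Z^{j-1},Z^jS,Z^{j+1},\dots)-f_{\ell-1}(\dots,Z^j,SZ^{j+1},Z^{j+2},\dots),$$ $$f_\ell(Z^1,\dots,Z^{\ell-1},[S,Y])=f_{\ell-1}(Z^1,\dots,Z^{\ell-2},Z^{\ell-1}S)-f_{\ell-1}(Z^1,\dots,Z^{\ell-1})S,$$ and moreover $$Sf_L(Z^1,\dots)=f_L(SZ^1,\dots),\quad f_L(\dots,Z^jS,Z^{j+1},\dots)=f_L(\dots,Z^j,SZ^{j+1},\dots),\quad f_L(\dots,Z^LS)=f_L(\dots,Z^L)S$$ for all $1\le j\le L-1$, $S\in\mathcal{C}(Y)$. For $L=0$, $(f_0)$ satisfies $\mathrm{IC}_0(Y)$ if $[f_0,\mathcal{C}(Y)]=0$. Completely bounded norm ($\Bbbk=\mathbb{C}$): an $\ell$-linear map $T:(M_s(\mathbb{C})^g)^\ell\to M_s(\mathbb{C})$ has ampliations $T_n:(M_{ns}(\mathbb{C})^g)^\ell\to M_{ns}(\mathbb{C})$, obtained by identifying $M_{ns}(\mathbb{C})^g=(M_s(\mathbb{C})^g)^{n\times n}$ and setting $T_n(Z^1,\dots,Z^\ell)_{ij}=\sum_{k_1,\dots,k_{\ell-1}}T(Z^1_{ik_1},Z^2_{k_1k_2},\dots,Z^\ell_{k_{\ell-1}j})$. For $X\in M_n(\mathbb{C})^g$ let $\|X\|$ be the maximum of the operator norms of its components. Then $\|T_n\|=\max\{\|T_n(Z^1,\dots,Z^\ell)\|:\|Z^1\|=\cdots=\|Z^\ell\|=1\}$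 and $\|T\|_{\rm cb}=\sup_n\|T_n\|$. *)

(* Defs.v *)
From HB Require Import structures.
From mathcomp Require Import all_boot all_order all_algebra.
From mathcomp Require Import all_classical all_reals all_analysis.
From mathcomp Require Import complex.

Set Implicit Arguments.
Unset Strict Implicit.
Unset Printing Implicit Defensive.

Import Order.TTheory GRing.Theory Num.Theory.

Local Open Scope classical_set_scope.
Local Open Scope ring_scope.

(* M_s(F)^g. A notation rather than a definition, so that the vector space
   structure of {ffun _ -> _} is inferred. *)
Notation mxpoint F s g := {ffun 'I_g -> 'M[F]_s}.

(* A family (f_l)_l with f_l : (M_s(F)^g)^l -> M_s(F). Finite sequences
   (f_l)_(l <= L) are also represented by such a family, of which only the
   members of index at most L are ever used. *)
Notation mapseq F s g :=
  (forall l : nat, l.-tuple (mxpoint F s g) -> 'M[F]_s).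

Section Points.
Variables (F : fieldType) (g : nat).

Definition lact s (S : 'M[F]_s) (Z : mxpoint F s g) : mxpoint F s g :=
  [ffun k => S *m Z k].

Definition ract s (Z : mxpoint F s g) (S : 'M[F]_s) : mxpoint F s g :=
  [ffun k => Z k *m S].

Definition brk s (S : 'M[F]_s) (Z : mxpoint F s g) : mxpoint F s g :=
  lact S Z - ract Z S.

Definition centralizes s (S : 'M[F]_s) (Y : mxpoint F s g) : Prop :=
  forall k, comm_mx S (Y k).

(* U encodes the subspace of F^s (column vectors) spanned by the transposes of
   its rows; this subspace is stable under Y_k iff U is stable under the right
   action of (Y k)^T. *)
Definition irreducible_point s (Y : mxpoint F s g) : Prop :=
  (0 < s)%N /\
  forall U : 'M[F]_s, (forall k, stablemx U (Y k)^T) ->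
    \rank U = 0%N \/ \rank U = s.

Definition similar_points s (X Y : mxpoint F s g) : Prop :=
  exists2 P : 'M[F]_s, P \in unitmx & forall k, Y k = P *m X k *m invmx P.

Definition direct_sum n (p : 'I_n -> nat) (X : forall i, mxpoint F (p i) g) :
    mxpoint F (\sum_(i < n) p i)%N g :=
  [ffun k => \mxdiag_(i < n) X i k].

Definition cast_point s t (e : s = t) (X : mxpoint F s g) : mxpoint F t g :=
  [ffun k => castmx (e, e) (X k)].

Definition semisimple_point s (Y : mxpoint F s g) : Prop :=
  exists n (p : 'I_n -> nat) (X : forall i, mxpoint F (p i) g)
         (e : (\sum_(i < n) p i)%N = s),
    (forall i, irreducible_point (X i)) /\
    similar_points (cast_point e (direct_sum X)) Y.

(* pi, viewed as an endomorphism of M_s(F)^g, is a C(Y)-bimodule projection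
   onto [M_s(F), Y]. *)
Definition bimodule_projection s (Y : mxpoint F s g)
    (pi : {linear mxpoint F s g -> mxpoint F s g}) : Prop :=
  [/\ forall Z, exists S, pi Z = brk S Y,
      forall S, pi (brk S Y) = brk S Y,
      forall S Z, centralizes S Y -> pi (lact S Z) = lact S (pi Z) &
      forall S Z, centralizes S Y -> pi (ract Z S) = ract (pi Z) S].

Section Families.
Variable s : nat.
Implicit Types (Y Z W : mxpoint F s g) (S : 'M[F]_s) (f h : mapseq F s g).

Definition tuple_upd (T : Type) l (t : l.-tuple T) (i : 'I_l) (x : T) :
    l.-tuple T :=
  [tuple (if j == i then x else tnth t j) | j < l].

Definition multilinear l (T : l.-tuple (mxpoint F s g) -> 'M[F]_s) : Prop :=
  forall (t : l.-tuple (mxpoint F s g)) (i : 'I_l),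
    linear (fun Z => T (tuple_upd t i Z)).

(* f_1([S,Y]) = [S,f_0] *)
Definition IC_first Y f : Prop :=
  forall S, f 1%N [tuple brk S Y] = S *m f 0%N [tuple] - f 0%N [tuple] *m S.

(* The three families of conditions expressing f_l through f_(l-1), l >= 2.
   In the middle one, [S,Y] stands between Z = Z^j and W = Z^(j+1), where
   j = a + 1, a = size A and l = a + b + 3. *)
Definition IC_at Y f (l : nat) : Prop :=
  [/\ forall m (A : m.-tuple (mxpoint F s g)) S Z, m.+2 = l ->
        f m.+2 [tuple of brk S Y :: Z :: A] =
        S *m f m.+1 [tuple of Z :: A] - f m.+1 [tuple of lact S Z :: A],
      forall a b (A : a.-tuple (mxpoint F s g)) (B : b.-tuple (mxpoint F s g))
          S Z W, (a + b.+3)%N = l ->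
        f (a + b.+3)%N [tuple of A ++ [:: Z, brk S Y, W & B]] =
        f (a + b.+2)%N [tuple of A ++ [:: ract Z S, W & B]]
        - f (a + b.+2)%N [tuple of A ++ [:: Z, lact S W & B]] &
      forall m (A : m.-tuple (mxpoint F s g)) S Z, m.+2 = l ->
        f m.+2 [tuple of rcons (rcons A Z) (brk S Y)] =
        f m.+1 [tuple of rcons A (ract Z S)]
        - f m.+1 [tuple of rcons A Z] *m S].

(* The conditions on the last map f_L, L >= 1, of a truncated sequence. *)
Definition IC_last Y f (L : nat) : Prop :=
  [/\ forall m (A : m.-tuple (mxpoint F s g)) S Z, m.+1 = L ->
        centralizes S Y ->
        S *m f m.+1 [tuple of Z :: A] = f m.+1 [tuple of lact S Z :: A],
      forall a b (A : a.-tuple (mxpoint F s g)) (B : b.-tuple (mxpoint F s g))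
          S Z W, (a + b.+2)%N = L -> centralizes S Y ->
        f (a + b.+2)%N [tuple of A ++ [:: ract Z S, W & B]] =
        f (a + b.+2)%N [tuple of A ++ [:: Z, lact S W & B]] &
      forall m (A : m.-tuple (mxpoint F s g)) S Z, m.+1 = L ->
        centralizes S Y ->
        f m.+1 [tuple of rcons A (ract Z S)] =
        f m.+1 [tuple of rcons A Z] *m S].

Definition IC Y f : Prop :=
  [/\ forall l, multilinear (f l),
      IC_first Y f &
      forall l, (2 <= l)%N -> IC_at Y f l].

Definition IC_trunc Y (L : nat) f : Prop :=
  (forall l, (l <= L)%N -> multilinear (f l)) /\
  if L == 0%N then
    forall S, centralizes S Y -> f 0%N [tuple] *m S - S *m f 0%N [tuple] = 0
  else
    [/\ IC_first Y f,
        forall l, (2 <= l <= L)%N -> IC_at Y f l &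
        IC_last Y f L].

Definition propagation Y (pi : {linear mxpoint F s g -> mxpoint F s g})
    (L : nat) f h : Prop :=
  [/\ forall l (t : l.-tuple (mxpoint F s g)), (l <= L)%N -> h l t = f l t,
      IC Y h &
      forall l (t : l.-tuple (mxpoint F s g)), (L < l)%N ->
        (forall i, pi (tnth t i) = 0) -> h l t = 0].

End Families.
End Points.

Section CompletelyBounded.
Variable R : realType.

Definition euclidean_norm m (v : 'cV[R[i]]_m) : R :=
  Num.sqrt (\sum_(a < m) ComplexField.Normc.normc (v a 0) ^+ 2).

Definition opnorm m (A : 'M[R[i]]_m) : R :=
  sup [set euclidean_norm (A *m v) | v in [set v | euclidean_norm v = 1]].

Definition point_norm m g (X : mxpoint R[i] m g) : R :=
  \big[Num.max/0]_(k < g) opnorm (X k).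

Variables s g : nat.

(* The (i,j) block Z_ij in M_s(C)^g of Z in M_(ns)(C)^g; the dimension ns is
   written as \sum_(i < n) s, as for all block matrices of the library. *)
Definition point_block n (Z : mxpoint R[i] (\sum_(i < n) s)%N g) (i j : 'I_n) :
    mxpoint R[i] s g :=
  [ffun k => @submxblock _ n n (fun=> s) (fun=> s) (Z k) i j].

(* The sum ranges over the paths i = k_0, k_1, ..., k_(l-1), k_l = j. *)
Definition ampliation n l (T : l.-tuple (mxpoint R[i] s g) -> 'M[R[i]]_s)
    (Z : l.-tuple (mxpoint R[i] (\sum_(i < n) s)%N g)) :
    'M[R[i]]_(\sum_(i < n) s)%N :=
  \mxblock_(i < n, j < n)
    \sum_(k : {ffun 'I_l.+1 -> 'I_n} | (k ord0 == i) && (k ord_max == j))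
      T [tuple point_block (tnth Z m) (k (widen_ord (leqnSn l) m))
                                      (k (lift ord0 m)) | m < l].

Definition ampliation_norm n l
    (T : l.-tuple (mxpoint R[i] s g) -> 'M[R[i]]_s) : \bar R :=
  ereal_sup [set (opnorm (ampliation (n := n) T Z))%:E |
             Z in [set Z | forall m, point_norm (tnth Z m) = 1]].

(* Valued in the extended reals: finiteness is not part of the definition. *)
Definition cb_norm l (T : l.-tuple (mxpoint R[i] s g) -> 'M[R[i]]_s) : \bar R :=
  ereal_sup [set ampliation_norm n T | n in [set n | (0 < n)%N]].

End CompletelyBounded.

(* Main.v *)
Require Import Defs.
From HB Require Import structures.
From mathcomp Require Import all_boot all_order all_algebra.
From mathcomp Require Import all_classical all_reals all_analysis.
From mathcomp Require Import complex ring lra.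
Import Order.TTheory GRing.Theory Num.Theory.
Local Open Scope classical_set_scope.
Local Open Scope ring_scope.

Set Implicit Arguments.
Unset Strict Implicit.
Unset Printing Implicit Defensive.

(** The intertwining conditions prescribe a multilinear map f_l as soon as one
    of its arguments is a commutator [S,Y], in terms of f_(l-1). Since every
    point is a commutator plus an element of ker pi, and f_l must vanish on
    (ker pi)^l for l > L, an expansion in all arguments determines f_l from
    f_(l-1); this is uniqueness ([propagation_unique]).

    For existence one peels the arguments off from the left: replace Z^1 by
    pi Z^1 = [S,Y] and use the prescribed value, then keep Z^1 - pi Z^1 and
    pass to Z^2, and so on ([extend]). Two points need care. First, S is only
    determined up to the centralizer C(Y), so f_(l-1) has to be balanced over
    C(Y), which is what the last conditions of IC_L(Y) say about f_L. Second,
    when two arguments are commutators, eliminating one or the other must give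
    the same value, which is [gap_comm]; with it the peeled definition
    telescopes to the prescribed value at every position
    ([extend_after_brk]). That f_l is balanced again, so that the construction
    can go on, follows from the same commutation: for S in C(Y) the
    commutator [S,Y] is zero, hence the balancing defect vanishes as soon as
    one argument is a commutator, and it vanishes on (ker pi)^l because ker pi
    is a C(Y)-bimodule ([extend_balanced]).

    For the growth over the complex numbers, a naive estimate of the peeled
    formula costs a factor |1 - pi|^l at each step and is far too large. One
    instead bounds f_l on arguments that all lie in im pi or in ker pi.
    Eliminating one commutator then disturbs a single neighbouring argument,
    and splitting that one again costs a constant factor
    ([bounded_on_adapted_step]); only at the end are arbitrary arguments split
    ([word_growth]). This gives |f_l| <= c K^l for the entrywise l^1 norm. The
    completely bounded norm exceeds such a bound by at most E^l with E
    depending on s and g alone: expanding the arguments in matrix units writes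
    the ampliation of T as a sum of products Z^1_(b_1) ... Z^l_(b_l) times
    T(e_(b_1), ..., e_(b_l)), where the coordinate blocks Z_b are no larger
    than Z whatever the size of the ampliation ([sqbound_amp]). *)

(** * Commutators and matrices placed between points *)

Lemma lincombD (R : pzRingType) (V : lmodType R) (a : R) (x y u v : V) :
  (a *: x + y) + (a *: u + v) = a *: (x + u) + (y + v).
Proof. by rewrite scalerDr addrACA. Qed.

Lemma lincombB (R : pzRingType) (V : lmodType R) (a : R) (x y u v : V) :
  (a *: x + y) - (a *: u + v) = a *: (x - u) + (y - v).
Proof. by rewrite opprD -scalerN lincombD. Qed.

Section WordFunctions.
Variables (F : fieldType) (g s : nat).
Local Notation pt := (mxpoint F s g).
Local Notation mat := 'M[F]_s.
Implicit Types (S T : mat) (Y Z W : pt) (A B C : seq pt).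
Implicit Types (Phi Psi : seq pt -> mat).

Lemma lactDl S T Z : lact (S + T) Z = lact S Z + lact T Z.
Proof. by apply/ffunP=> k; rewrite !ffunE mulmxDl. Qed.

Lemma lactZl a S Z : lact (a *: S) Z = a *: lact S Z.
Proof. by apply/ffunP=> k; rewrite !ffunE scalemxAl. Qed.

Lemma lact_lin S a Z W : lact S (a *: Z + W) = a *: lact S Z + lact S W.
Proof. by apply/ffunP=> k; rewrite !ffunE mulmxDr scalemxAr. Qed.

Lemma ractDr Z S T : ract Z (S + T) = ract Z S + ract Z T.
Proof. by apply/ffunP=> k; rewrite !ffunE mulmxDr. Qed.

Lemma ractZr a Z S : ract Z (a *: S) = a *: ract Z S.
Proof. by apply/ffunP=> k; rewrite !ffunE scalemxAr. Qed.

Lemma ract_lin a Z W S : ract (a *: Z + W) S = a *: ract Z S + ract W S.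
Proof. by apply/ffunP=> k; rewrite !ffunE mulmxDl scalemxAl. Qed.

Lemma lact_mul S T Z : lact S (lact T Z) = lact (S *m T) Z.
Proof. by apply/ffunP=> k; rewrite !ffunE mulmxA. Qed.

Lemma ract_mul S T Z : ract (ract Z S) T = ract Z (S *m T).
Proof. by apply/ffunP=> k; rewrite !ffunE mulmxA. Qed.

Lemma lact_ract S T Z : lact S (ract Z T) = ract (lact S Z) T.
Proof. by apply/ffunP=> k; rewrite !ffunE mulmxA. Qed.

Lemma brk_lin a S T Y : brk (a *: S + T) Y = a *: brk S Y + brk T Y.
Proof.
by rewrite /brk lactDl ractDr lactZl ractZr lincombB.
Qed.

Lemma brk_centralizes S Y : (brk S Y = 0) <-> centralizes S Y.
Proof.
split=> [/ffunP e k|e]; last first.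
  by apply/ffunP=> k; rewrite !ffunE e subrr.
by have := e k; rewrite !ffunE => /eqP; rewrite subr_eq0 => /eqP.
Qed.

(** The derivation rule [ST,Y] = S[T,Y] + [S,Y]T is what makes two adjacent
    commutators compatible. *)
Lemma brk_mul S T Y : brk (S *m T) Y = lact S (brk T Y) + ract (brk S Y) T.
Proof.
apply/ffunP=> k; rewrite !ffunE mulmxBr mulmxBl !mulmxA.
by rewrite addrA subrK.
Qed.

(** A bare matrix placed at a gap of a word of points is absorbed by a
    neighbouring point; [head_lact] and [last_ract] perform the absorption, and
    at an end of the word, where there is no neighbour, the matrix survives as
    the outer factor [end_factor]. *)
Definition head_lact S B : seq pt :=
  if B is Z :: B' then lact S Z :: B' else [::].

Definition last_ract S A : seq pt :=
  if A is Z :: A' then rcons (belast Z A') (ract (last Z A') S) else [::].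

Definition end_factor S A : mat := if A is [::] then S else 1%:M.

(** The common right-hand side of all the intertwining conditions, for a
    commutator [S,Y] standing between the words A and B: the difference between
    absorbing S to the left and to the right. Treating the two ends like inner
    gaps merges the three families of conditions, the one for f_1, and the
    invariance of f_0 into a single formula. *)
Definition gap Phi S A B : mat :=
  end_factor S A *m Phi (last_ract S A ++ B)
  - Phi (A ++ head_lact S B) *m end_factor S B.

Definition mlin Phi := forall a Z W A B,
  Phi (A ++ (a *: Z + W) :: B) = a *: Phi (A ++ Z :: B) + Phi (A ++ W :: B).

Definition intertwines Y Psi Phi := forall S A B,
  Phi (A ++ brk S Y :: B) = gap Psi S A B.

Definition balanced Y Phi := forall S A B,
  centralizes S Y -> gap Phi S A B = 0.

Lemma last_ract_rcons S A Z : last_ract S (rcons A Z) = rcons A (ract Z S).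
Proof. by case: A => //= W A; rewrite belast_rcons last_rcons. Qed.

Lemma end_factor_rcons S A Z : end_factor S (rcons A Z) = 1%:M.
Proof. by case: A. Qed.

Lemma last_ract_cat S A Z B :
  last_ract S (A ++ Z :: B) = A ++ last_ract S (Z :: B).
Proof.
by rewrite (lastI Z B) -rcons_cat !last_ract_rcons rcons_cat.
Qed.

Lemma end_factor_cat S A Z B : end_factor S (A ++ Z :: B) = 1%:M.
Proof. by case: A. Qed.

Lemma size_head_lact S B : size (head_lact S B) = size B.
Proof. by case: B. Qed.

Lemma size_last_ract S A : size (last_ract S A) = size A.
Proof. by case: A => //= Z A; rewrite size_rcons size_belast. Qed.

Lemma gap_ext Phi Psi S A B :
  (forall w, size w = (size A + size B)%N -> Phi w = Psi w) ->
  gap Phi S A B = gap Psi S A B.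
Proof.
move=> e; rewrite /gap !e // size_cat ?size_last_ract //.
by rewrite size_head_lact.
Qed.

Lemma mlin0 Phi A B : mlin Phi -> Phi (A ++ 0 :: B) = 0.
Proof.
move=> /(_ 1 0 0 A B); rewrite scaler0 addr0 scale1r => /eqP.
by rewrite -subr_eq0 opprD addNKr oppr_eq0 => /eqP.
Qed.

Lemma mlinD Phi Z W A B : mlin Phi ->
  Phi (A ++ (Z + W) :: B) = Phi (A ++ Z :: B) + Phi (A ++ W :: B).
Proof. by move=> /(_ 1 Z W A B); rewrite !scale1r. Qed.

Section GapMultilinear.
Variables (Phi : seq pt -> mat) (Phi_lin : mlin Phi).

Lemma gap_linS a S T A B :
  gap Phi (a *: S + T) A B = a *: gap Phi S A B + gap Phi T A B.
Proof.
rewrite /gap.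
have -> : end_factor (a *: S + T) A *m Phi (last_ract (a *: S + T) A ++ B) =
   a *: (end_factor S A *m Phi (last_ract S A ++ B)) +
   end_factor T A *m Phi (last_ract T A ++ B).
  case: (lastP A) => [|A' Z] /=; first by rewrite mulmxDl scalemxAl.
  rewrite !end_factor_rcons !mul1mx !last_ract_rcons !cat_rcons ractDr ractZr.
  exact: Phi_lin.
have -> : Phi (A ++ head_lact (a *: S + T) B) *m end_factor (a *: S + T) B =
   a *: (Phi (A ++ head_lact S B) *m end_factor S B) +
   Phi (A ++ head_lact T B) *m end_factor T B.
  case: B => [|Z B] /=; first by rewrite mulmxDr scalemxAr.
  by rewrite !mulmx1 lactDl lactZl Phi_lin.
exact: lincombB.
Qed.

Lemma gapB S T A B : gap Phi (S - T) A B = gap Phi S A B - gap Phi T A B.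
Proof. by rewrite addrC -scaleN1r gap_linS scaleN1r addrC. Qed.

Lemma gap_linA S a Z W A1 A2 B :
  gap Phi S (A1 ++ (a *: Z + W) :: A2) B =
  a *: gap Phi S (A1 ++ Z :: A2) B + gap Phi S (A1 ++ W :: A2) B.
Proof.
rewrite /gap !end_factor_cat !mul1mx.
have -> : Phi (last_ract S (A1 ++ (a *: Z + W) :: A2) ++ B) =
   a *: Phi (last_ract S (A1 ++ Z :: A2) ++ B) +
   Phi (last_ract S (A1 ++ W :: A2) ++ B).
  case: (lastP A2) => [|A2' U].
    by rewrite !cats1 !last_ract_rcons !cat_rcons ract_lin Phi_lin.
  rewrite !last_ract_cat -!rcons_cons !last_ract_rcons -!catA /=.
  exact: Phi_lin.
have -> : Phi ((A1 ++ (a *: Z + W) :: A2) ++ head_lact S B) =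
   a *: Phi ((A1 ++ Z :: A2) ++ head_lact S B) +
   Phi ((A1 ++ W :: A2) ++ head_lact S B).
  by rewrite -!catA /= Phi_lin.
by rewrite mulmxDl -scalemxAl lincombB.
Qed.

Lemma gap_linB S a Z W A B1 B2 :
  gap Phi S A (B1 ++ (a *: Z + W) :: B2) =
  a *: gap Phi S A (B1 ++ Z :: B2) + gap Phi S A (B1 ++ W :: B2).
Proof.
rewrite /gap !end_factor_cat !mulmx1.
have -> : Phi (last_ract S A ++ B1 ++ (a *: Z + W) :: B2) =
   a *: Phi (last_ract S A ++ B1 ++ Z :: B2) +
   Phi (last_ract S A ++ B1 ++ W :: B2).
  by rewrite !catA Phi_lin.
have -> : Phi (A ++ head_lact S (B1 ++ (a *: Z + W) :: B2)) =
   a *: Phi (A ++ head_lact S (B1 ++ Z :: B2)) +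
   Phi (A ++ head_lact S (B1 ++ W :: B2)).
  case: B1 => [|U B1] /=; first by rewrite lact_lin Phi_lin.
  by rewrite -!cat_cons !catA Phi_lin.
by rewrite mulmxDr -scalemxAr lincombB.
Qed.

End GapMultilinear.

(** Two commutators can be eliminated in either order. When some point
    separates them, the two eliminations touch different sides of the letters
    between them and commute; when they are adjacent, the claim is the
    derivation rule for [ST,Y]. *)
Lemma gap_comm Y Psi Phi S T A B C : mlin Phi -> intertwines Y Psi Phi ->
  gap Phi S A (B ++ brk T Y :: C) = gap Phi T (A ++ brk S Y :: B) C.
Proof.
move=> Phi_lin rel.
case: B => [|Z B].
  rewrite /= /gap /= mulmx1 cats1 last_ract_rcons end_factor_rcons mul1mx.
  rewrite !cat_rcons.
  have -> : lact S (brk T Y) = (-1) *: ract (brk S Y) T + brk (S *m T) Y.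
    by rewrite brk_mul scaleN1r [lact _ _ + _]addrC addKr.
  rewrite Phi_lin !rel scaleN1r /gap.
  have -> : last_ract T (last_ract S A) = last_ract (S *m T) A.
    by case: (lastP A) => // A' U; rewrite !last_ract_rcons ract_mul.
  have -> : head_lact S (head_lact T C) = head_lact (S *m T) C.
    by case: C => //= U C; rewrite lact_mul.
  have end_left X : end_factor S A *m (end_factor T (last_ract S A) *m X) =
      end_factor (S *m T) A *m X.
    rewrite mulmxA; congr (_ *m _); case: (lastP A) => // A' U.
    by rewrite !last_ract_rcons !end_factor_rcons mul1mx.
  have end_right X : X *m end_factor S (head_lact T C) *m end_factor T C =
      X *m end_factor (S *m T) C.
    by rewrite -mulmxA; case: C => [|U C] //=; rewrite mul1mx.
  rewrite mulmxBr mulmxBl end_left end_right mulmxA opprD opprK !opprB.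
  by rewrite addrC -!addrA addKr.
have inner D : head_lact S (last_ract T (Z :: B) ++ D) =
    last_ract T (lact S Z :: B) ++ D.
  case: (lastP B) => [|B' U] /=; first by rewrite lact_ract.
  by rewrite !belast_rcons !last_rcons.
have nonempty : end_factor S (last_ract T (Z :: B) ++ C) = 1%:M.
  by case: (lastP B) => // B' U; rewrite -rcons_cons last_ract_rcons.
rewrite /gap !end_factor_cat !mul1mx !mulmx1.
have -> : last_ract T (A ++ brk S Y :: Z :: B) =
    A ++ brk S Y :: last_ract T (Z :: B).
  by rewrite -[brk S Y :: Z :: B]cat1s catA last_ract_cat -catA.
have -> : Phi (last_ract S A ++ (Z :: B) ++ brk T Y :: C) =
    gap Psi T (last_ract S A ++ Z :: B) C by rewrite catA rel.
have -> : Phi (A ++ head_lact S ((Z :: B) ++ brk T Y :: C)) =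
    gap Psi T (A ++ lact S Z :: B) C by rewrite -rel /= -catA.
rewrite -!catA !cat_cons !rel /gap !end_factor_cat !mul1mx nonempty mulmx1.
rewrite !last_ract_cat inner -!catA /= !mulmx1 mulmxBr mulmxBl !mulmxA.
rewrite !opprB !addrA.
rewrite -!addrA; congr (_ + _).
by rewrite [LHS]addrC [RHS]addrCA -addrA.
Qed.

(** * Extension by one degree *)

Section Extension.
Variables (Y : pt) (pi : {linear pt -> pt}).
Hypothesis pi_proj : bimodule_projection Y pi.

Definition kernel_word A := all (fun Z => pi Z == 0) A.

Lemma pi_image Z : exists S, pi Z = brk S Y.
Proof. by case: pi_proj. Qed.

Lemma pi_brk S : pi (brk S Y) = brk S Y.
Proof. by case: pi_proj. Qed.

Lemma pi_idem Z : pi (pi Z) = pi Z.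
Proof. by have [S ->] := pi_image Z; rewrite pi_brk. Qed.

Lemma pi_compl Z : pi (Z - pi Z) = 0.
Proof. by rewrite linearB /= pi_idem subrr. Qed.

Lemma kernel_word_last_ract S A : centralizes S Y ->
  kernel_word A -> kernel_word (last_ract S A).
Proof.
move=> cS; case: (lastP A) => // A' Z; rewrite last_ract_rcons.
rewrite /kernel_word !all_rcons => /andP[/eqP Z0 ->]; rewrite andbT.
case: pi_proj => _ _ _ ->//; rewrite Z0.
by apply/eqP/ffunP=> k; rewrite !ffunE mul0mx.
Qed.

Lemma kernel_word_head_lact S A : centralizes S Y ->
  kernel_word A -> kernel_word (head_lact S A).
Proof.
move=> cS; case: A => //= Z A /andP[/eqP Z0 ->]; rewrite andbT.
case: pi_proj => _ _ -> // _; rewrite Z0.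
by apply/eqP/ffunP=> k; rewrite !ffunE mulmx0.
Qed.

(** Every point splits as a commutator plus an element of the kernel, so these
    two kinds of letters determine a multilinear map. *)
Lemma mlin_eq0 Phi w : mlin Phi ->
  (forall S A B, Phi (A ++ brk S Y :: B) = 0) ->
  (forall A, kernel_word A -> Phi A = 0) -> Phi w = 0.
Proof.
move=> Phi_lin brk0 ker0; rewrite -[w]cat0s.
have: kernel_word [::] by [].
elim: w [::] => [|Z w IH] A kerA; first by rewrite cats0 ker0.
rewrite -[Z](subrK (pi Z)) mlinD //.
have -> : Phi (A ++ pi Z :: w) = 0 by have [S ->] := pi_image Z.
rewrite addr0 -cat_rcons IH // /kernel_word all_rcons.
by rewrite pi_compl eqxx.
Qed.

Section OneStep.
Variables (sigma : pt -> mat) (sigmaP : forall Z, brk (sigma Z) Y = pi Z).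

(** Reads a word from left to right: A is the part already read, with its
    letters projected to ker pi, and the next letter is replaced by the
    commutator [sigma Z, Y] = pi Z. The term with all letters in ker pi is the
    final 0. *)
Fixpoint extend_after Phi A B : mat :=
  if B is Z :: B' then
    gap Phi (sigma Z) A B' + extend_after Phi (rcons A (Z - pi Z)) B'
  else 0.

Definition extend Phi B := extend_after Phi [::] B.

Variables (Phi : seq pt -> mat).
Hypotheses (Phi_lin : mlin Phi) (Phi_bal : balanced Y Phi).

(** Balancing over C(Y) is exactly what makes the value prescribed on [S,Y]
    independent of the choice of S. *)
Lemma gap_mod_centralizer S T A B : brk S Y = brk T Y ->
  gap Phi S A B = gap Phi T A B.
Proof.
move=> e; apply/eqP; rewrite -subr_eq0 -gapB // Phi_bal //.
apply/brk_centralizes; rewrite addrC -scaleN1r brk_lin e scaleN1r.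
exact: addNr.
Qed.

Lemma extend_after_linA a Z W A1 A2 B :
  extend_after Phi (A1 ++ (a *: Z + W) :: A2) B =
  a *: extend_after Phi (A1 ++ Z :: A2) B +
  extend_after Phi (A1 ++ W :: A2) B.
Proof.
elim: B A2 => [|U B IH] A2 /=; first by rewrite scaler0 addr0.
by rewrite gap_linA // !rcons_cat !rcons_cons IH lincombD.
Qed.

Lemma extend_after_linB a Z W A B1 B2 :
  extend_after Phi A (B1 ++ (a *: Z + W) :: B2) =
  a *: extend_after Phi A (B1 ++ Z :: B2) +
  extend_after Phi A (B1 ++ W :: B2).
Proof.
elim: B1 A => [|U B1 IH] A /=.
  rewrite (@gap_mod_centralizer _ (a *: sigma Z + sigma W)); last first.
    by rewrite brk_lin !sigmaP linearP.
  have -> : a *: Z + W - pi (a *: Z + W) = a *: (Z - pi Z) + (W - pi W).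
    by rewrite linearP lincombB.
  by rewrite gap_linS // -!cats1 extend_after_linA lincombD.
by rewrite gap_linB // IH lincombD.
Qed.

Lemma extend_mlin : mlin (extend Phi).
Proof. by move=> a Z W A B; apply: extend_after_linB. Qed.

Lemma extend_kernel B : kernel_word B -> extend Phi B = 0.
Proof.
rewrite /extend; elim: B [::] => //= Z B IH A /andP[/eqP Z0 kerB].
rewrite IH // addr0 Phi_bal //.
by apply/brk_centralizes; rewrite sigmaP.
Qed.

Variables (Psi : seq pt -> mat) (Phi_rel : intertwines Y Psi Phi).

(** When the commutator is at some position, each earlier letter contributes
    by [gap_comm] the prescribed value at that position with pi Z as this
    letter; together with the projected letters read so far these sums
    telescope. Later letters contribute nothing, since a commutator has zero
    projection to ker pi. *)
Lemma extend_after_brk T A B C :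
  extend_after Phi A (B ++ brk T Y :: C) = gap Phi T (A ++ B) C.
Proof.
elim: B A => [|Z B IH] A /=.
  rewrite cats0 (@gap_mod_centralizer _ T) ?sigmaP ?pi_brk // subrr.
  rewrite -[RHS]addr0; congr (_ + _).
  have := extend_after_linA (-1) 0 0 A [::] C.
  by rewrite scaler0 addr0 cats1 scaleN1r addNr.
rewrite IH (gap_comm _ _ _ _ _ Phi_lin Phi_rel) sigmaP cat_rcons.
have := gap_linA Phi_lin T 1 (pi Z) (Z - pi Z) A B C.
by rewrite !scale1r addrC subrK => ->.
Qed.

Lemma extend_intertwines : intertwines Y Phi (extend Phi).
Proof. by move=> S A B; apply: extend_after_brk. Qed.

Lemma gap_zeroA Xi S A B C : mlin Xi -> gap Xi S (A ++ 0 :: B) C = 0.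
Proof.
move=> Xi_lin; have := gap_linA Xi_lin S (-1) 0 0 A B C.
by rewrite scaler0 addr0 scaleN1r addNr.
Qed.

Lemma gap_zeroB Xi S A B C : mlin Xi -> gap Xi S A (B ++ 0 :: C) = 0.
Proof.
move=> Xi_lin; have := gap_linB Xi_lin S (-1) 0 0 A B C.
by rewrite scaler0 addr0 scaleN1r addNr.
Qed.

(** The defect S |-> [gap (extend Phi) S] is itself multilinear, so
    [mlin_eq0] applies to it. On a word with a commutator [T,Y], [gap_comm]
    exchanges S and T and brings in the letter [S,Y] = 0; on words of ker pi
    both terms are values on words of ker pi. *)
Lemma extend_balanced : balanced Y (extend Phi).
Proof.
move=> S A B cS; have brk_S : brk S Y = 0 by apply/brk_centralizes.
(* A single word carries both sides of the gap, so that [mlin_eq0] can treat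
   its letters uniformly; n remembers where the gap is. *)
pose n := size A.
pose Xi w := gap (extend Phi) S (take n w) (drop n w).
suff : Xi (A ++ B) = 0 by rewrite /Xi take_size_cat // drop_size_cat.
apply: mlin_eq0 => [a Z W A' B'|T A' B'|w kerw].
- rewrite /Xi !take_cat !drop_cat; case: ltnP => leA'.
    by rewrite gap_linB //; apply: extend_mlin.
  case: (n - size A')%N => [|m] /=; last first.
    by rewrite gap_linA //; apply: extend_mlin.
  by rewrite cats0 -[_ :: B']cat0s gap_linB //; apply: extend_mlin.
- have comm := gap_comm _ _ _ _ _ extend_mlin extend_intertwines.
  rewrite /Xi !take_cat !drop_cat; case: ltnP => leA'.
    by rewrite comm brk_S gap_zeroA //; apply: extend_mlin.
  case: (n - size A')%N => [|m] /=.
    by rewrite cats0 -[_ :: B']cat0s comm brk_S gap_zeroA //;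
      apply: extend_mlin.
  by rewrite -comm brk_S gap_zeroB //; apply: extend_mlin.
- have /andP[kerA kerB] : kernel_word (take n w) && kernel_word (drop n w).
    by rewrite /kernel_word -all_cat cat_take_drop.
  rewrite /Xi /gap !extend_kernel ?mulmx0 ?mul0mx ?subrr //.
    rewrite /kernel_word all_cat; apply/andP; split=> //.
    exact: kernel_word_head_lact.
  rewrite /kernel_word all_cat; apply/andP; split=> //.
  exact: kernel_word_last_ract.
Qed.

End OneStep.
End Extension.

(** * From tuples to words *)

(** Setting a family to zero off length n lets the conditions linking two
    consecutive members be stated for words of every length. *)
Definition truncate n Phi : seq pt -> mat :=
  fun w => if size w == n then Phi w else 0.

Definition mlin_at l Phi := forall a Z W A B, (size A + size B).+1 = l ->
  Phi (A ++ (a *: Z + W) :: B) = a *: Phi (A ++ Z :: B) + Phi (A ++ W :: B).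

Definition intertwines_at Y l Phi := forall S A B,
  (size A + size B)%N = l -> Phi (A ++ brk S Y :: B) = gap Phi S A B.

Definition balanced_at Y l Phi := forall S A B,
  (size A + size B)%N = l -> centralizes S Y -> gap Phi S A B = 0.

Lemma gap_truncate n Phi S A B : gap (truncate n Phi) S A B =
  if (size A + size B == n)%N then gap Phi S A B else 0.
Proof.
rewrite /gap /truncate !size_cat size_last_ract size_head_lact.
by case: eqP => _; rewrite ?mulmx0 ?mul0mx ?subrr.
Qed.

Lemma truncate_mlin n Phi : mlin_at n Phi -> mlin (truncate n Phi).
Proof.
move=> Phi_lin a Z W A B; rewrite /truncate !size_cat /=.
by case: eqP => [|_]; rewrite ?scaler0 ?addr0 // addnS => /Phi_lin->.
Qed.

Lemma truncate_balanced Y n Phi : balanced_at Y n Phi ->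
  balanced Y (truncate n Phi).
Proof.
move=> Phi_bal S A B cS; rewrite gap_truncate.
by case: eqP => // e; apply: Phi_bal.
Qed.

Lemma truncate_intertwines Y n Phi : intertwines_at Y n Phi ->
  intertwines Y (truncate n Phi) (truncate n.+1 Phi).
Proof.
move=> Phi_rel S A B; rewrite gap_truncate /truncate size_cat /= addnS eqSS.
by case: eqP => // e; apply: Phi_rel.
Qed.

Section Words.
Implicit Types f h : mapseq F s g.

(** A family indexed by tuple lengths is the same as one function on words;
    concatenation of words then needs no transport along equalities of
    lengths. *)
Definition word_fun f : seq pt -> mat := fun w => f (size w) (in_tuple w).

Definition tuple_fun Phi : mapseq F s g := fun l t => Phi t.

Lemma word_funE f l (t : l.-tuple pt) : word_fun f t = f l t.
Proof.
case: t => w e; have el := eqP e; subst l.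
by congr (f _ _); apply: val_inj.
Qed.

Lemma tuple_funK Phi : word_fun (tuple_fun Phi) = Phi.
Proof. by apply/funext=> w. Qed.

Lemma tuple_updE l (t : l.-tuple pt) (i : 'I_l) Z :
  tuple_upd t i Z = take i t ++ Z :: drop i.+1 t :> seq pt.
Proof.
apply: (@eq_from_nth _ 0) => [|j].
  rewrite size_cat /= size_takel ?size_drop !size_tuple; last exact: ltnW.
  by rewrite subnSK // subnKC ?card_ord // ltnW.
rewrite size_tuple ?card_ord => lt_jl.
rewrite -(tnth_nth 0 _ (Ordinal lt_jl)) tnth_mktuple nth_cat.
rewrite size_takel ?size_tuple; last by rewrite ltnW.
rewrite -val_eqE /=; case: ltngtP => [lt_ji|lt_ij|->]; last 1 first.
- by rewrite subnn.
- by rewrite nth_take // (tnth_nth 0).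
- rewrite -(subnSK lt_ij) /= nth_drop subnKC // (tnth_nth 0) //.
Qed.

Lemma multilinearP f l : multilinear (f l) <-> mlin_at l (word_fun f).
Proof.
split=> [lin a Z W A B e|lin t i a Z W].
  have sz : size (A ++ Z :: B) == l by rewrite size_cat /= addnS e.
  have lt_il : (size A < l)%N by rewrite -e ltnS leq_addr.
  have upd U : tuple_upd (Tuple sz) (Ordinal lt_il) U = A ++ U :: B :> seq pt.
    by rewrite tuple_updE /= take_size_cat // -[A ++ Z :: B]cat_rcons
      drop_size_cat ?size_rcons.
  rewrite -(upd Z) -(upd W) -(upd (a *: Z + W)) !word_funE.
  exact: (lin (Tuple sz) (Ordinal lt_il) a Z W).
rewrite /= -!word_funE !tuple_updE; apply: lin.
rewrite size_takel ?size_drop size_tuple; last exact: ltnW.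
by rewrite -addnS subnSK // subnKC // ltnW.
Qed.

Lemma IC_firstP Y f : IC_first Y f <-> intertwines_at Y 0 (word_fun f).
Proof.
split=> [ic S [|//] [|//] _|ic S].
  by have := ic S; rewrite -!word_funE.
by have := ic S [::] [::] erefl; rewrite -!word_funE.
Qed.

Lemma IC_atP Y f l : IC_at Y f l.+2 <-> intertwines_at Y l.+1 (word_fun f).
Proof.
split=> [[icl icm icr] S A B e|ic].
  case: (lastP A) e => [|A' Z]; case: B => [|W B] // e.
  - have := icl _ (in_tuple B) S W; rewrite -!word_funE /gap /= mulmx1; apply.
    by case: e => ->.
  - have := icr _ (in_tuple A') S Z; rewrite -!word_funE /gap /=.
    rewrite last_ract_rcons end_factor_rcons !cats1 !cats0 mul1mx; apply.
    by move: e; rewrite size_rcons addn0 => -[->].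
  - have := icm _ _ (in_tuple A') (in_tuple B) S Z W.
    rewrite -!word_funE /gap /= mulmx1.
    rewrite last_ract_rcons end_factor_rcons !cat_rcons mul1mx; apply.
    by move: e; rewrite size_rcons /= addSn !addnS => -[->].
split=> [m A S Z [e]|a b A B S Z W e|m A S Z [e]].
- have := ic S [::] (Z :: A); rewrite /gap /= mulmx1 -!word_funE; apply.
  by rewrite /= size_tuple e.
- have := ic S (rcons A Z) (W :: B); rewrite -!word_funE /gap /= mulmx1.
  rewrite last_ract_rcons end_factor_rcons !cat_rcons mul1mx; apply.
  by move: e; rewrite size_rcons /= !size_tuple addSn !addnS => -[->].
- have := ic S (rcons A Z) [::]; rewrite -!word_funE /gap /=.
  rewrite last_ract_rcons end_factor_rcons !cats1 !cats0 mul1mx; apply.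
  by rewrite size_rcons size_tuple addn0 e.
Qed.

Lemma IC_last_balanced Y f l : IC_last Y f l.+1 ->
  balanced_at Y l.+1 (word_fun f).
Proof.
move=> [icl icm icr] S A B e cS; apply/eqP; rewrite subr_eq0; apply/eqP.
case: (lastP A) e => [|A' Z]; case: B => [|W B] // e.
- have := icl _ (in_tuple B) S W; rewrite -!word_funE /= mulmx1; exact.
- have := icr _ (in_tuple A') S Z; rewrite -!word_funE /=.
  rewrite last_ract_rcons end_factor_rcons !cats0 mul1mx; apply=> //.
  by move: e; rewrite size_rcons addn0 => -[->].
- have := icm _ _ (in_tuple A') (in_tuple B) S Z W.
  rewrite -!word_funE /= mulmx1.
  rewrite last_ract_rcons end_factor_rcons !cat_rcons mul1mx; apply=> //.
  by move: e; rewrite size_rcons /= addSn !addnS => -[->].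
Qed.

Lemma ICP Y f : IC Y f <-> mlin (word_fun f) /\
  intertwines Y (word_fun f) (word_fun f).
Proof.
split=> [[lin ic1 ic]|[lin rel]].
  split=> [a Z W A B|S A B].
    exact: (multilinearP f (size A + size B).+1).1.
  case e : (size A + size B)%N => [|l]; first exact: (IC_firstP Y f).1.
  exact: (IC_atP Y f l).1 (ic l.+2 isT) S A B e.
split=> [l||[|[|l]] // _].
- by apply/multilinearP => a Z W A B _; exact: lin.
- by apply/IC_firstP => S A B _; exact: rel.
- by apply/IC_atP => S A B _; exact: rel.
Qed.

Lemma IC_trunc_at Y L f l : IC_trunc Y L f -> (l < L)%N ->
  intertwines_at Y l (word_fun f).
Proof.
case=> _; case: L => // L [ic1 ic _]; case: l => [|l] lt_lL.
  exact/IC_firstP.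
by apply/IC_atP/ic; rewrite /= -ltnS.
Qed.

Lemma IC_trunc_balanced Y L f : IC_trunc Y L f ->
  balanced_at Y L (word_fun f).
Proof.
case=> _; case: L => [ic [] // S [|//] [|//] _ cS|L [_ _]]; last first.
  exact: IC_last_balanced.
apply/eqP; rewrite -oppr_eq0 opprB /gap /=.
by rewrite -[[::]]/(tval [tuple]) !word_funE ic.
Qed.

End Words.

(** * Existence and uniqueness of the propagation *)

Section Propagation.
Variables (Y : pt) (pi : {linear pt -> pt}).
Hypothesis pi_proj : bimodule_projection Y pi.
Variables (L : nat) (f : mapseq F s g).
Hypothesis f_ic : IC_trunc Y L f.

(** Below length L the given maps are kept, and from L on the one-step
    extension is iterated. Length L itself belongs to both descriptions, so
    each condition between consecutive lengths falls under one of them. *)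
Lemma propagation_exists : exists h, propagation Y pi L f h.
Proof.
have /choice [sigma sigma_pi] : forall Z, exists S, pi Z = brk S Y.
  by case: pi_proj.
have sigmaP Z : brk (sigma Z) Y = pi Z by [].
pose Phi n := iter n (extend pi sigma) (truncate L (word_fun f)).
have PhiP n : [/\ mlin (Phi n), balanced Y (Phi n) &
    exists Psi, intertwines Y Psi (Phi n)].
  elim: n => [|n [Phi_lin Phi_bal [Psi Phi_rel]]].
    split.
    - exact/truncate_mlin/multilinearP/(f_ic.1 L (leqnn L)).
    - exact/truncate_balanced/IC_trunc_balanced.
    rewrite /Phi /=; case: L f_ic => [|L'] ic; last first.
      exists (truncate L' (word_fun f)).
      by apply: truncate_intertwines; apply: IC_trunc_at ic _.
    (* f_0 has no argument, so it intertwines with the zero map. *)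
    exists (fun=> 0) => S A B.
    by rewrite /gap !mulmx0 mul0mx subrr /truncate size_cat addnS.
  split.
  - exact: extend_mlin.
  - exact: (extend_balanced pi_proj sigmaP Phi_lin Phi_bal Phi_rel).
  - exists (Phi n).
    exact: (extend_intertwines pi_proj sigmaP Phi_lin Phi_bal Phi_rel).
have Phi_rel n : intertwines Y (Phi n) (Phi n.+1).
  have [Phi_lin Phi_bal [Psi Phi_rel]] := PhiP n.
  exact: (extend_intertwines pi_proj sigmaP Phi_lin Phi_bal Phi_rel).
pose H w := if (size w < L)%N then word_fun f w else Phi (size w - L)%N w.
have H_low w : (size w <= L)%N -> H w = word_fun f w.
  rewrite /H leq_eqVlt; case/predU1P=> [e|->] //.
  by rewrite e ltnn subnn /Phi /= /truncate e eqxx.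
have H_high w : (L <= size w)%N -> H w = Phi (size w - L)%N w.
  by move=> leL; rewrite /H ltnNge leL.
exists (tuple_fun H); split.
- move=> l t le_lL; rewrite -[LHS]word_funE tuple_funK H_low ?size_tuple //.
  exact: word_funE.
- apply/ICP; rewrite tuple_funK; split=> [a Z W A B|S A B].
    case: (ltnP (size A + size B)%N L) => [lt_L|le_L].
      rewrite !H_low ?size_cat ?addnS //.
      by have /multilinearP := f_ic.1 _ lt_L; apply.
    rewrite !H_high ?size_cat ?addnS ?(leqW le_L) //.
    by have [lin _ _] := PhiP ((size A + size B).+1 - L)%N; rewrite lin.
  case: (ltnP (size A + size B)%N L) => [lt_L|le_L].
    rewrite H_low ?size_cat ?addnS //.
    rewrite (IC_trunc_at f_ic lt_L) //; apply: gap_ext => w ew.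
    by rewrite H_low // ew ltnW.
  rewrite H_high ?size_cat ?addnS ?(leqW le_L) // subSn // Phi_rel.
  by apply: gap_ext => w ew; rewrite H_high ew.
- move=> l t lt_Ll ker_t; rewrite -word_funE tuple_funK H_high; last first.
    by rewrite size_tuple ltnW.
  rewrite size_tuple -(subnSK lt_Ll).
  have [Phi_lin Phi_bal _] := PhiP (l - L.+1)%N.
  apply: (extend_kernel sigmaP) => //.
  by apply/all_tnthP => i; apply/eqP/ker_t.
Qed.

(** The difference of two propagations in degree l vanishes on words of ker pi
    and, by induction on l, on words containing a commutator. *)
Lemma propagation_unique h h' : propagation Y pi L f h ->
  propagation Y pi L f h' -> forall l (t : l.-tuple pt), h' l t = h l t.
Proof.
move=> [h_f /ICP[h_lin h_rel] h_ker] [h'_f /ICP[h'_lin h'_rel] h'_ker] l t.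
elim/ltn_ind: l t => l IH t.
case: (leqP l L) => [le_lL|lt_Ll]; first by rewrite h_f // h'_f.
pose D := truncate l (fun w => word_fun h' w - word_fun h w).
suff: D t = 0.
  by rewrite /D /truncate size_tuple eqxx !word_funE => /eqP; rewrite subr_eq0
    => /eqP.
apply: (mlin_eq0 pi_proj) => [|S A B|A kerA].
- by apply: truncate_mlin => a Z W A B _; rewrite h_lin h'_lin lincombB.
- rewrite /D /truncate size_cat /=; case: eqP => // e.
  rewrite h_rel h'_rel; apply/eqP; rewrite subr_eq0; apply/eqP/gap_ext => w ew.
  rewrite -[w]/(tval (in_tuple w)) !word_funE; apply: IH.
  by rewrite -e ew addnS.
- rewrite /D /truncate; case: eqP => // e; rewrite -e in lt_Ll.
  rewrite -[A]/(tval (in_tuple A)) !word_funE h_ker ?h'_ker ?subrr //.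
    by move=> i; apply/eqP/(allP kerA)/mem_tnth.
  by move=> i; apply/eqP/(allP kerA)/mem_tnth.
Qed.

End Propagation.
End WordFunctions.

(** * Entrywise norms and bounds for multilinear maps *)

Section EntrywiseNorm.
Variable R : realType.
Local Notation normc := (@ComplexField.Normc.normc R).

Lemma normc_ge0 (x : R[i]) : 0 <= normc x.
Proof. by case: x => a b; apply: sqrtr_ge0. Qed.

Lemma normcD (x y : R[i]) : normc (x + y) <= normc x + normc y.
Proof. exact: le_normcD. Qed.

Definition mnorm m n (A : 'M[R[i]]_(m, n)) : R :=
  \sum_i \sum_j normc (A i j).

Lemma mnorm_ge0 m n (A : 'M[R[i]]_(m, n)) : 0 <= mnorm A.
Proof.
by apply: sumr_ge0 => i _; apply: sumr_ge0 => j _; apply: normc_ge0.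
Qed.

Lemma mnorm0 m n : mnorm (0 : 'M[R[i]]_(m, n)) = 0.
Proof.
by apply: big1 => i _; apply: big1 => j _;
  rewrite mxE ComplexField.Normc.normc0.
Qed.

Lemma mnormD m n (A B : 'M[R[i]]_(m, n)) : mnorm (A + B) <= mnorm A + mnorm B.
Proof.
rewrite -big_split; apply: ler_sum => i _; rewrite -big_split.
by apply: ler_sum => j _; rewrite mxE; apply: normcD.
Qed.

Lemma mnormZ m n a (A : 'M[R[i]]_(m, n)) : mnorm (a *: A) = normc a * mnorm A.
Proof.
rewrite mulr_sumr; apply: eq_bigr => i _; rewrite mulr_sumr.
by apply: eq_bigr => j _; rewrite mxE ComplexField.Normc.normcM.
Qed.

Lemma mnormN m n (A : 'M[R[i]]_(m, n)) : mnorm (- A) = mnorm A.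
Proof.
apply: eq_bigr => i _; apply: eq_bigr => j _; rewrite mxE; exact: normcN.
Qed.

Lemma mnormB m n (A B : 'M[R[i]]_(m, n)) : mnorm (A - B) <= mnorm A + mnorm B.
Proof. by rewrite -(mnormN B) mnormD. Qed.

Lemma mnorm_sum m n (I : Type) (r : seq I) (A : I -> 'M[R[i]]_(m, n)) :
  mnorm (\sum_(i <- r) A i) <= \sum_(i <- r) mnorm (A i).
Proof.
elim/big_rec2: _ => [|i x y _ le_yx]; first by rewrite mnorm0.
by apply: le_trans (mnormD _ _) _; rewrite lerD2l.
Qed.

Lemma normc_sum (I : Type) (r : seq I) (x : I -> R[i]) :
  normc (\sum_(i <- r) x i) <= \sum_(i <- r) normc (x i).
Proof.
elim/big_rec2: _ => [|i y z _ le_zy].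
  by rewrite ComplexField.Normc.normc0.
by apply: le_trans (normcD _ _) _; rewrite lerD2l.
Qed.

Lemma mnormM m n p (A : 'M[R[i]]_(m, n)) (B : 'M[R[i]]_(n, p)) :
  mnorm (A *m B) <= mnorm A * mnorm B.
Proof.
rewrite /mnorm mulr_suml; apply: ler_sum => i _.
have entry j : normc ((A *m B) i j) <= \sum_k normc (A i k) * normc (B k j).
  rewrite mxE; apply: le_trans (normc_sum _ _) _.
  by apply: ler_sum => k _; rewrite ComplexField.Normc.normcM.
apply: le_trans (ler_sum _ (fun j _ => entry j)) _.
rewrite exchange_big mulr_suml; apply: ler_sum => k _.
rewrite -mulr_sumr ler_wpM2l ?normc_ge0 //.
rewrite [leRHS](bigD1 k) //= lerDl.
by apply: sumr_ge0 => l _; apply: sumr_ge0 => j _; apply: normc_ge0.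
Qed.

Section Points.
Variables s g : nat.
Local Notation pt := (mxpoint R[i] s g).
Implicit Types (Z W : pt) (w A B : seq pt) (b : 'I_g * 'I_s * 'I_s).

Definition pt_entry b Z : R[i] := Z b.1.1 b.1.2 b.2.

Definition unit_pt b : pt :=
  [ffun k => if k == b.1.1 then delta_mx b.1.2 b.2 else 0].

Definition pnorm Z : R := \sum_k mnorm (Z k).

Lemma pnorm_ge0 Z : 0 <= pnorm Z.
Proof. by apply: sumr_ge0 => k _; apply: mnorm_ge0. Qed.

Lemma pnorm_coord Z : pnorm Z = \sum_b normc (pt_entry b Z).
Proof.
rewrite -(pair_bigA _ (fun x j => normc (pt_entry (x, j) Z))) /=.
rewrite -(pair_bigA _ (fun k i => \sum_j normc (pt_entry (k, i, j) Z))) /=.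
by [].
Qed.

Lemma pnormD Z W : pnorm (Z + W) <= pnorm Z + pnorm W.
Proof.
by rewrite -big_split; apply: ler_sum => k _; rewrite ffunE mnormD.
Qed.

Lemma pnormB Z W : pnorm (Z - W) <= pnorm Z + pnorm W.
Proof.
by rewrite -big_split; apply: ler_sum => k _; rewrite !ffunE mnormB.
Qed.

Lemma pnormZ a Z : pnorm (a *: Z) = normc a * pnorm Z.
Proof.
by rewrite mulr_sumr; apply: eq_bigr => k _; rewrite ffunE mnormZ.
Qed.

Lemma pnorm_sum (I : Type) (r : seq I) (Z : I -> pt) :
  pnorm (\sum_(i <- r) Z i) <= \sum_(i <- r) pnorm (Z i).
Proof.
elim/big_rec2: _ => [|i x y _ le_yx].
  by rewrite /pnorm big1 // => k _; rewrite ffunE mnorm0.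
by apply: le_trans (pnormD _ _) _; rewrite lerD2l.
Qed.

Lemma pnorm_lact S Z : pnorm (lact S Z) <= mnorm S * pnorm Z.
Proof.
by rewrite mulr_sumr; apply: ler_sum => k _; rewrite ffunE mnormM.
Qed.

Lemma pnorm_ract S Z : pnorm (ract Z S) <= pnorm Z * mnorm S.
Proof.
by rewrite mulr_suml; apply: ler_sum => k _; rewrite ffunE mnormM.
Qed.

Lemma pnorm_unit b : pnorm (unit_pt b) = 1.
Proof.
rewrite pnorm_coord (bigD1 b) //= big1 => [|c neq_cb].
  by rewrite /pt_entry ffunE eqxx mxE !eqxx addr0 ComplexField.Normc.normc1.
rewrite /pt_entry ffunE; case: eqP => [e1|_]; last first.
  by rewrite mxE ComplexField.Normc.normc0.
rewrite mxE; case: andP => [[/eqP e2 /eqP e3]|_]; last first.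
  by rewrite ComplexField.Normc.normc0.
by move: neq_cb; case: c b e1 e2 e3 => [[k i] j] [[k' i'] j'] /= -> -> ->;
  rewrite eqxx.
Qed.

Lemma unit_pt_sum Z : Z = \sum_b pt_entry b Z *: unit_pt b.
Proof.
apply/ffunP=> k; rewrite sum_ffunE.
rewrite -(pair_bigA _ (fun x j => (pt_entry (x, j) Z *: unit_pt (x, j)) k)) /=.
rewrite -(pair_bigA _ (fun k' i => \sum_j
  (pt_entry (k', i, j) Z *: unit_pt (k', i, j)) k)) /=.
rewrite (bigD1 k) //= [X in _ + X]big1 ?addr0 => [|k' neq_k]; last first.
  apply: big1 => i _; apply: big1 => j _.
  by rewrite !ffunE /= eq_sym (negbTE neq_k) scaler0.
rewrite [LHS]matrix_sum_delta; apply: eq_bigr => i _; apply: eq_bigr => j _.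
by rewrite !ffunE /= eqxx.
Qed.

Lemma linear_expand (V : lmodType R[i]) (phi : pt -> V) Z :
  (forall a Z W, phi (a *: Z + W) = a *: phi Z + phi W) ->
  phi Z = \sum_b pt_entry b Z *: phi (unit_pt b).
Proof.
move=> phi_lin; have phi0 : phi 0 = 0.
  by have := phi_lin (-1) 0 0; rewrite scaler0 addr0 scaleN1r addNr.
rewrite {1}[Z]unit_pt_sum.
elim/big_rec2: _ => // b x y _ <-; exact: phi_lin.
Qed.

Lemma coord_le_pnorm b Z : normc (pt_entry b Z) <= pnorm Z.
Proof.
rewrite pnorm_coord (bigD1 b) //= lerDl.
by apply: sumr_ge0 => c _; apply: normc_ge0.
Qed.

Lemma mnorm_comb (M : 'I_g * 'I_s * 'I_s -> 'M[R[i]]_s) Z :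
  mnorm (\sum_b pt_entry b Z *: M b) <= (\sum_b mnorm (M b)) * pnorm Z.
Proof.
apply: le_trans (mnorm_sum _ _) _; rewrite mulr_suml; apply: ler_sum => b _.
by rewrite mnormZ mulrC ler_wpM2l ?mnorm_ge0 // coord_le_pnorm.
Qed.

Lemma linear_pnorm_bound (pi : {linear pt -> pt}) :
  exists2 p, 0 <= p & forall Z, pnorm (pi Z) <= p * pnorm Z.
Proof.
exists (\sum_b pnorm (pi (unit_pt b))) => [|Z].
  by apply: sumr_ge0 => b _; apply: pnorm_ge0.
rewrite (@linear_expand _ pi Z); last by move=> a U W; apply: linearP.
apply: le_trans (pnorm_sum _ _) _; rewrite mulr_suml; apply: ler_sum => b _.
by rewrite pnormZ mulrC ler_wpM2l ?pnorm_ge0 // coord_le_pnorm.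
Qed.

Definition wnorm w : R := \prod_(Z <- w) pnorm Z.

Lemma wnorm_ge0 w : 0 <= wnorm w.
Proof. by apply: prodr_ge0 => Z _; apply: pnorm_ge0. Qed.

Lemma wnorm_cat A Z B : wnorm (A ++ Z :: B) = wnorm A * pnorm Z * wnorm B.
Proof. by rewrite /wnorm big_cat big_cons /= mulrA. Qed.

Lemma wnorm_nil : wnorm [::] = 1. Proof. exact: big_nil. Qed.

Lemma wnorm_cons Z B : wnorm (Z :: B) = pnorm Z * wnorm B.
Proof. exact: big_cons. Qed.

Definition bounded_on_words n c (Phi : seq pt -> 'M[R[i]]_s) :=
  forall w, size w = n -> mnorm (Phi w) <= c * wnorm w.

Lemma mlin_bounded_on_words Phi n : mlin Phi ->
  exists2 c, 0 <= c & bounded_on_words n c Phi.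
Proof.
elim: n Phi => [|n IH] Phi Phi_lin.
  exists (mnorm (Phi [::])) => [|[] // _]; first exact: mnorm_ge0.
  by rewrite wnorm_nil mulr1.
have /choice [c cP] b : exists c, 0 <= c /\
    bounded_on_words n c (fun w => Phi (unit_pt b :: w)).
  have [|c c0 cP] := IH (fun w => Phi (unit_pt b :: w)); last by exists c.
  by move=> a Z W A B; have := Phi_lin a Z W (unit_pt b :: A) B.
exists (\sum_b c b) => [|[//|Z w] [sz_w]].
  by apply: sumr_ge0 => b _; have [] := cP b.
rewrite (@linear_expand _ (fun Z => Phi (Z :: w)) Z); last first.
  by move=> a U W; have := Phi_lin a U W [::] w.
apply: le_trans (mnorm_sum _ _) _; rewrite mulr_suml; apply: ler_sum => b _.
have [c0 cbP] := cP b; rewrite mnormZ wnorm_cons mulrCA.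
by rewrite ler_pM ?normc_ge0 ?mnorm_ge0 ?coord_le_pnorm // cbP.
Qed.

(** * Exponential growth of an intertwining family *)

Section Growth.
Variables (Y : pt) (pi : {linear pt -> pt}).
Hypothesis pi_proj : bimodule_projection Y pi.

(** Preimages chosen on matrix units and extended linearly have linearly
    bounded size. *)
Lemma brk_preimage_bound : exists2 k, 0 <= k &
  forall Z, exists2 S, pi Z = brk S Y & mnorm S <= k * pnorm Z.
Proof.
have /choice [sigma sigmaP] : forall Z, exists S, pi Z = brk S Y.
  by case: pi_proj.
exists (\sum_b mnorm (sigma (unit_pt b))) => [|Z].
  by apply: sumr_ge0 => b _; apply: mnorm_ge0.
exists (\sum_b pt_entry b Z *: sigma (unit_pt b)); last exact: mnorm_comb.
rewrite (@linear_expand _ pi Z); last by move=> a U W; apply: linearP.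
elim/big_rec2: _ => [|b x y _ ->]; last by rewrite sigmaP brk_lin.
by apply/esym/brk_centralizes => k; rewrite /comm_mx mul0mx mulmx0.
Qed.

(** On these words a commutator can be eliminated without projecting the other
    letters, so that no power of the norm of 1 - pi accumulates. *)
Definition adapted w := all (fun Z => (pi Z == Z) || (pi Z == 0)) w.

Lemma adapted_insert A Z B :
  adapted (A ++ Z :: B) = [&& adapted [:: Z], adapted A & adapted B].
Proof. by rewrite /adapted all_cat /= andbT andbCA. Qed.

Variables (p k : R).
Hypotheses (p_ge0 : 0 <= p) (k_ge0 : 0 <= k).
Hypothesis pi_bound : forall Z, pnorm (pi Z) <= p * pnorm Z.
Hypothesis brk_bound :
  forall Z, exists2 S, pi Z = brk S Y & mnorm S <= k * pnorm Z.
Let q := p + (1 + p).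

Lemma q_ge1 : 1 <= q. Proof. by rewrite /q addrCA lerDl addr_ge0. Qed.
Lemma q_ge0 : 0 <= q. Proof. exact: le_trans q_ge1. Qed.

Lemma compl_bound Z : pnorm (Z - pi Z) <= (1 + p) * pnorm Z.
Proof. by apply: le_trans (pnormB _ _) _; rewrite mulrDl mul1r lerD2l. Qed.

Definition bounded_on_adapted n c (Phi : seq pt -> 'M[R[i]]_s) :=
  forall w, size w = n -> adapted w -> mnorm (Phi w) <= c * wnorm w.

Variables (H : seq pt -> 'M[R[i]]_s) (H_lin : mlin H).
Hypothesis H_rel : intertwines Y H H.

Lemma adapted_pi Z : adapted [:: pi Z].
Proof. by rewrite /= (pi_idem pi_proj) eqxx. Qed.

Lemma adapted_compl Z : adapted [:: Z - pi Z].
Proof. by rewrite /= (pi_compl pi_proj) eqxx orbT. Qed.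

(** An arbitrary letter among adapted ones is split into its two projections;
    q is the sum of the bounds of the two projections. *)
Lemma split_bound c U A B :
  0 <= c ->
  (forall V, adapted [:: V] ->
    mnorm (H (A ++ V :: B)) <= c * (wnorm A * pnorm V * wnorm B)) ->
  mnorm (H (A ++ U :: B)) <= q * c * (wnorm A * pnorm U * wnorm B).
Proof.
move=> c0 HV; rewrite -{1}[U](subrK (pi U)) addrC (mlinD _ _ _ _ H_lin).
apply: le_trans (mnormD _ _) _; rewrite [q * c * _](_ : _ =
  c * (wnorm A * (p * pnorm U) * wnorm B) +
  c * (wnorm A * ((1 + p) * pnorm U) * wnorm B)); last first.
  rewrite /q; set a := wnorm A; set u := pnorm U; set b := wnorm B.
  ring.
apply: lerD; [apply: le_trans (HV _ (adapted_pi _)) _ |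
  apply: le_trans (HV _ (adapted_compl _)) _]; rewrite ler_wpM2l //;
  rewrite ler_wpM2r ?wnorm_ge0 // ler_wpM2l ?wnorm_ge0 //.
exact: compl_bound.
Qed.

(** In each term of the gap only the letter next to S leaves the adapted
    class, hence a single use of [split_bound]; this is why the constant is
    independent of n. *)
Lemma adapted_gap_bound n c S A B : 0 <= c -> bounded_on_adapted n c H ->
  (size A + size B)%N = n -> adapted A -> adapted B ->
  mnorm (gap H S A B) <= 2 * q * c * mnorm S * (wnorm A * wnorm B).
Proof.
move=> c0 Hc szAB adA adB; rewrite /gap.
have letter U A' B' : (size A' + size B').+1 = n -> adapted A' -> adapted B' ->
    mnorm (H (A' ++ U :: B')) <= q * c * (wnorm A' * pnorm U * wnorm B').
  move=> sz adA' adB'; apply: split_bound => // V adV; rewrite -wnorm_cat.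
  apply: Hc; first by rewrite size_cat /= addnS.
  by rewrite adapted_insert adV adA' adB'.
have cq : c <= q * c by rewrite ler_peMl // q_ge1.
have wAB : 0 <= wnorm A * wnorm B by rewrite mulr_ge0 ?wnorm_ge0.
have HAB : mnorm (H (A ++ B)) <= q * c * (wnorm A * wnorm B).
  apply: le_trans (Hc _ _ _) _; rewrite ?size_cat //.
    by rewrite /adapted all_cat; apply/andP.
  by rewrite /wnorm big_cat /= ler_wpM2r.
rewrite -!mulrA mulr2n mulrDl !mul1r !mulrA.
apply: le_trans (mnormB _ _) _; apply: lerD.
- case: (lastP A) szAB adA wAB HAB => [|A' Z] szAB adA wAB HAB /=.
    apply: le_trans (mnormM _ _) _.
    rewrite [leRHS](_ : _ = mnorm S * (q * c * (wnorm [::] * wnorm B))).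
      by rewrite ler_wpM2l ?mnorm_ge0.
    ring.
  rewrite end_factor_rcons mul1mx last_ract_rcons cat_rcons.
  move: adA; rewrite -cats1 adapted_insert => /and3P[_ adA _].
  apply: le_trans (letter _ _ _ _ _ _) _ => //.
    by move: szAB; rewrite size_rcons.
  rewrite wnorm_cat wnorm_nil.
  rewrite [leRHS](_ : _ =
    q * c * (wnorm A' * (pnorm Z * mnorm S) * wnorm B)); last by ring.
  rewrite ler_wpM2l ?mulr_ge0 ?q_ge0 // ler_wpM2r ?wnorm_ge0 //.
  by rewrite ler_wpM2l ?wnorm_ge0 // pnorm_ract.
- case: B szAB adB wAB HAB => [|Z B] szAB adB wAB HAB.
    apply: le_trans (mnormM _ _) _; rewrite /=.
    rewrite [leRHS](_ : _ = (q * c * (wnorm A * wnorm [::])) * mnorm S).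
      by rewrite ler_wpM2r ?mnorm_ge0.
    ring.
  rewrite /= mulmx1.
  move: adB => /andP[_ adB].
  apply: le_trans (letter _ _ _ _ _ _) _ => //.
    by move: szAB; rewrite /= addnS.
  rewrite wnorm_cons.
  rewrite [leRHS](_ : _ =
    q * c * (wnorm A * (mnorm S * pnorm Z) * wnorm B)); last by ring.
  rewrite ler_wpM2l ?mulr_ge0 ?q_ge0 // ler_wpM2r ?wnorm_ge0 //.
  by rewrite ler_wpM2l ?wnorm_ge0 // pnorm_lact.
Qed.

Variable L : nat.
Hypothesis H_ker : forall w, (L < size w)%N -> kernel_word pi w -> H w = 0.

(** Beyond length L a word of ker pi is killed, and any other adapted word has
    a letter [S,Y] with S of size comparable to that letter. *)
Lemma bounded_on_adapted_step n c : (L <= n)%N -> 0 <= c ->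
  bounded_on_adapted n c H ->
  bounded_on_adapted n.+1 (2 * q * k * c) H.
Proof.
move=> leLn c0 Hc w szw adw.
case: (boolP (kernel_word pi w)) => [kerw|/allPn[Z wZ piZ]].
  rewrite H_ker ?szw // mnorm0 mulr_ge0 ?wnorm_ge0 //.
  by rewrite !mulr_ge0 ?q_ge0.
case/splitPr: wZ szw adw => A B; rewrite size_cat /= addnS => -[szw].
rewrite adapted_insert => /and3P[/= piZZ adA adB].
rewrite (negbTE piZ) orbF andbT in piZZ; move/eqP: piZZ => piZZ.
have [S eS le_S] := brk_bound Z.
rewrite -{1}piZZ eS H_rel.
apply: le_trans (adapted_gap_bound _ _ Hc _ _ _) _ => //.
rewrite wnorm_cat.
rewrite [leRHS](_ : _ =
  2 * q * c * (k * pnorm Z) * (wnorm A * wnorm B)); last by ring.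
by rewrite ler_wpM2r ?mulr_ge0 ?wnorm_ge0 // ler_wpM2l // !mulr_ge0 ?q_ge0.
Qed.

Lemma adapted_growth : exists c K, [/\ 0 <= c, 0 <= K &
  forall n, bounded_on_adapted n (c * K ^+ n) H].
Proof.
have /choice [c cP] n : exists c, 0 <= c /\ bounded_on_words n c H.
  by have [c c0 cP] := mlin_bounded_on_words n H_lin; exists c.
have c_ge0 n : 0 <= c n by have [] := cP n.
(* C serves all lengths up to L, where multilinearity gives the bounds c n. *)
pose C := \sum_(n < L.+1) c n; pose K := 1 + 2 * q * k.
have K_ge1 : 1 <= K by rewrite lerDl !mulr_ge0 ?q_ge0.
have K_ge0 : 0 <= K by apply: le_trans K_ge1.
have C_ge0 : 0 <= C by apply: sumr_ge0.
exists C, K; split=> // n; elim: n => [|n IH].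
all: have low m : (m <= L)%N -> bounded_on_adapted m (C * K ^+ m) H.
1,3: move=> le_mL w szw _; apply: le_trans ((cP m).2 w szw) _.
1,2: rewrite ler_wpM2r ?wnorm_ge0 //.
1,2: rewrite -[leLHS]mulr1 ler_pM ?exprn_ege1 //.
1,2: rewrite /C (bigD1 (Ordinal (le_mL : (m < L.+1)%N))) //= lerDl.
1,2: exact: sumr_ge0.
  exact: low.
case: (leqP n.+1 L) => [/low //|leLn] w szw adw.
apply: le_trans (bounded_on_adapted_step leLn _ IH szw adw) _.
  by rewrite mulr_ge0 ?exprn_ge0.
rewrite ler_wpM2r ?wnorm_ge0 // exprS [leRHS]mulrCA ler_wpM2r ?lerDr //.
by rewrite mulr_ge0 ?exprn_ge0.
Qed.

(** Splitting each of the n letters of a word once costs q^n. *)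
Lemma word_growth : exists c K, [/\ 0 <= c, 0 <= K &
  forall n, bounded_on_words n (c * K ^+ n) H].
Proof.
have [c [K [c_ge0 K_ge0 HcK]]] := adapted_growth.
exists c, (q * K); split=> [||_ w <-] //; first by rewrite mulr_ge0 ?q_ge0.
(* The letters of A are already split, those of B are not. *)
suff suffix_bound A B : adapted A -> mnorm (H (A ++ B)) <=
    c * K ^+ (size A + size B) * q ^+ size B * (wnorm A * wnorm B).
  have := suffix_bound [::] w isT.
  by rewrite wnorm_nil mul1r exprMn [q ^+ _ * _]mulrC mulrA.
elim: B A => [|Z B IH] A adA.
  rewrite cats0 addn0 expr0 mulr1 wnorm_nil mulr1.
  exact: HcK.
have -> : wnorm A * wnorm (Z :: B) = wnorm A * pnorm Z * wnorm B.
  by rewrite wnorm_cons mulrA.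
rewrite [q ^+ _]exprS [c * _ * _]mulrCA; apply: split_bound => [|V adV].
  by rewrite !mulr_ge0 ?exprn_ge0 ?q_ge0.
rewrite -cat_rcons.
have := IH (rcons A V); rewrite size_rcons -cats1 wnorm_cat.
rewrite wnorm_nil mulr1 adapted_insert adV adA /= addSnnS.
exact.
Qed.

End Growth.
End Points.
End EntrywiseNorm.

(** * Euclidean bounds for block matrices *)

Section SquareNorm.
Variable R : realType.
Local Notation normc := (@ComplexField.Normc.normc R).

Definition sqnorm m (v : 'cV[R[i]]_m) : R := \sum_(a < m) normc (v a 0) ^+ 2.

Lemma sqnorm_ge0 m (v : 'cV[R[i]]_m) : 0 <= sqnorm v.
Proof. by apply: sumr_ge0 => a _; apply: sqr_ge0. Qed.

Lemma sqnorm0 m : sqnorm (0 : 'cV[R[i]]_m) = 0.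
Proof.
by apply: big1 => a _; rewrite mxE ComplexField.Normc.normc0 expr0n.
Qed.

Lemma sqnormZ m c (v : 'cV[R[i]]_m) : sqnorm (c *: v) = normc c ^+ 2 * sqnorm v.
Proof.
rewrite mulr_sumr; apply: eq_bigr => a _.
by rewrite mxE ComplexField.Normc.normcM exprMn.
Qed.

(** The constant 2 replaces the sharp triangle inequality: constants that
    depend only on s and g are harmless for exponential growth. *)
Lemma sqnormD m (u v : 'cV[R[i]]_m) :
  sqnorm (u + v) <= 2 * (sqnorm u + sqnorm v).
Proof.
rewrite -big_split mulr_sumr; apply: ler_sum => a _; rewrite mxE.
set x := u a 0; set y := v a 0.
have := normcD x y; have := normc_ge0 (x + y).
move: (normc (x + y)) (normc x) (normc y) => z p q z0 le_z.
apply: (@le_trans _ _ ((p + q) ^+ 2)).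
  by rewrite ler_sqr ?nnegrE //; apply: le_trans le_z.
rewrite /= -subr_ge0 (_ : _ - _ = (p - q) ^+ 2) ?sqr_ge0 //; ring.
Qed.

Lemma sqnorm_sum m (I : finType) (v : I -> 'cV[R[i]]_m) :
  sqnorm (\sum_i v i) <= 2 ^+ #|I| * \sum_i sqnorm (v i).
Proof.
rewrite cardE /index_enum -enumT; elim: (enum I) => [|i r IH].
  by rewrite !big_nil sqnorm0 mulr0.
rewrite !big_cons /= exprS -mulrA.
apply: le_trans (sqnormD _ _) _; rewrite ler_wpM2l // mulrDr lerD //.
by rewrite ler_peMl ?sqnorm_ge0 // exprn_ege1 // ler1n.
Qed.

Definition sqbound m (A : 'M[R[i]]_m) (c : R) :=
  forall v, sqnorm (A *m v) <= c * sqnorm v.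

Lemma sqboundM m (A B : 'M[R[i]]_m) a b : 0 <= a ->
  sqbound A a -> sqbound B b -> sqbound (A *m B) (a * b).
Proof.
move=> a0 Aa Bb v; rewrite -mulmxA; apply: le_trans (Aa _) _.
by rewrite -mulrA ler_wpM2l.
Qed.

Lemma sqbound_sum m (I : finType) (A : I -> 'M[R[i]]_m) a :
  (forall i, sqbound (A i) a) ->
  sqbound (\sum_i A i) (2 ^+ #|I| * #|I|%:R * a).
Proof.
move=> Aa v; rewrite mulmx_suml; apply: le_trans (sqnorm_sum _) _.
rewrite -!mulrA ler_wpM2l ?exprn_ge0 //.
apply: le_trans (ler_sum _ (fun i _ => Aa i v)) _.
by rewrite sumr_const mulr_natl.
Qed.

Lemma sqbound_mnorm m (A : 'M[R[i]]_m) :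
  sqbound A (2 ^+ m * m%:R * mnorm A ^+ 2).
Proof.
move=> v; have -> : A *m v = \sum_j v j 0 *: col j A.
  apply/colP => i; rewrite mxE summxE; apply: eq_bigr => j _.
  by rewrite !mxE mulrC.
apply: le_trans (sqnorm_sum _) _; rewrite card_ord -!mulrA.
rewrite ler_wpM2l ?exprn_ge0 // [in leRHS]/sqnorm !mulr_sumr.
apply: ler_sum => j _.
rewrite sqnormZ [leLHS]mulrC [leRHS](_ : _ =
  m%:R * mnorm A ^+ 2 * normc (v j 0) ^+ 2); last by rewrite expr2 !mulrA.
rewrite ler_wpM2r ?sqr_ge0 //.
have entry i : normc (col j A i 0) ^+ 2 <= mnorm A ^+ 2.
  rewrite mxE ler_sqr ?nnegrE ?normc_ge0 ?mnorm_ge0 //.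
  rewrite /mnorm (bigD1 i) //= (bigD1 j) //= -addrA lerDl.
  apply: addr_ge0; apply: sumr_ge0 => k _; first exact: normc_ge0.
  by apply: sumr_ge0 => l _; apply: normc_ge0.
apply: le_trans (ler_sum _ (fun i _ => entry i)) _.
by rewrite sumr_const card_ord mulr_natl.
Qed.

Lemma mnorm_delta m n (p : 'I_m) (q : 'I_n) :
  mnorm (delta_mx p q : 'M[R[i]]_(m, n)) = 1.
Proof.
rewrite /mnorm (bigD1 p) //= (bigD1 q) //= !big1 => [|k neq_k|k neq_k].
- by rewrite mxE !eqxx ComplexField.Normc.normc1 !addr0.
- by apply: big1 => l _; rewrite mxE (negbTE neq_k) ComplexField.Normc.normc0.
- by rewrite mxE (negbTE neq_k) andbF ComplexField.Normc.normc0.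
Qed.

Section Blocks.
Variables n s : nat.
Local Notation ns := (\sum_(i < n) s)%N.

Lemma sqnorm_mxcol (v : 'I_n -> 'cV[R[i]]_s) :
  sqnorm (\mxcol_(i < n) v i) = \sum_i sqnorm (v i).
Proof.
rewrite /sqnorm sig_big_dep /= (reindex _ tagnat.sig_bij_on) /=.
by apply: eq_bigr => a _; rewrite mxE.
Qed.

Lemma sqbound_mxdiag (A : 'M[R[i]]_s) a :
  sqbound A a -> sqbound (\mxdiag_(i < n) A) a.
Proof.
move=> Aa v; rewrite -[v]submxcolK mul_mxdiag_mxcol !sqnorm_mxcol mulr_sumr.
exact: ler_sum.
Qed.

Lemma mxdiag_sandwich (A B : 'M[R[i]]_s) (M : 'M[R[i]]_ns) :
  (\mxdiag_(i < n) A) *m M *m (\mxdiag_(i < n) B) =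
  \mxblock_(i < n, j < n) (A *m (submxblock M i j : 'M[R[i]]_s) *m B).
Proof.
rewrite -[in LHS](submxblockK M).
by rewrite (mul_mxdiag_mxblock (fun=> A)) (mul_mxblock_mxdiag _ (fun=> B)).
Qed.

End Blocks.

(** * Ampliations *)

Definition block_const (s : nat) : R := 2 ^+ s * s%:R.

Definition coord_const (s : nat) : R :=
  2 ^+ s * s%:R * (block_const s * 1 * block_const s).

(** The cost of expanding one argument of a multilinear map in the N matrix
    units of M_s^g. It must not depend on the number of blocks n. *)
Definition amp_rate (s g : nat) : R :=
  let N := #|{: 'I_g * 'I_s * 'I_s}| in 2 ^+ N * N%:R * coord_const s.

Lemma block_const_ge0 s : 0 <= block_const s.
Proof. by rewrite mulr_ge0 ?exprn_ge0. Qed.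

Lemma coord_const_ge0 s : 0 <= coord_const s.
Proof. by rewrite !mulr_ge0 ?exprn_ge0 ?block_const_ge0. Qed.

Lemma amp_rate_ge0 s g : 0 <= amp_rate s g.
Proof. by rewrite !mulr_ge0 ?exprn_ge0 ?coord_const_ge0. Qed.

Section Ampliations.
Variables s g n : nat.
Local Notation pt := (mxpoint R[i] s g).
Local Notation ns := (\sum_(i < n) s)%N.
Local Notation bigpt := (mxpoint R[i] ns g).
Implicit Types (Z : bigpt) (Zs : seq bigpt) (b : 'I_g * 'I_s * 'I_s).
Implicit Types (Phi : seq pt -> 'M[R[i]]_s) (i j : 'I_n).

(** The sum over paths that defines an ampliation, organized by first step so
    that it can be estimated one argument at a time. *)
Fixpoint amp_entry Phi Zs i j : 'M[R[i]]_s :=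
  if Zs is Z :: Zs' then
    \sum_k amp_entry (fun w => Phi (point_block Z i k :: w)) Zs' k j
  else if i == j then Phi [::] else 0.

Definition amp Phi Zs : 'M[R[i]]_ns :=
  \mxblock_(i < n, j < n) amp_entry Phi Zs i j.

(** The tensor product of the n x n matrix of b-coordinates of the blocks of Z
    with the identity of size s. *)
Definition coord_mx b Z : 'M[R[i]]_ns :=
  \mxblock_(i < n, j < n) ((pt_entry b (point_block Z i j))%:M : 'M[R[i]]_s).

Lemma amp_entry_comb Zs i j (I : finType) (c : I -> R[i])
    (Phi : I -> seq pt -> 'M[R[i]]_s) :
  amp_entry (fun w => \sum_a c a *: Phi a w) Zs i j =
  \sum_a c a *: amp_entry (Phi a) Zs i j.
Proof.
elim: Zs Phi i => [|Z Zs IH] Phi i /=.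
  by case: eqP => // _; rewrite big1 // => a _; rewrite scaler0.
under [LHS]eq_bigr do rewrite IH.
by rewrite exchange_big; apply: eq_bigr => a _; rewrite scaler_sumr.
Qed.

(** Expanding the blocks of the first argument in matrix units turns the first
    step of the paths into a matrix product. *)
Lemma amp_cons Phi Z Zs : mlin Phi -> amp Phi (Z :: Zs) =
  \sum_b coord_mx b Z *m amp (fun w => Phi (unit_pt _ b :: w)) Zs.
Proof.
move=> Phi_lin; rewrite /amp /coord_mx.
under [RHS]eq_bigr do rewrite mul_mxblock.
rewrite -mxblock_sum; apply/eq_mxblock => i j /=.
rewrite [RHS]exchange_big; apply: eq_bigr => k _.
have -> : (fun w => Phi (point_block Z i k :: w)) = (fun w => \sum_b
    pt_entry b (point_block Z i k) *: Phi (unit_pt _ b :: w)).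
  apply/funext=> w.
  rewrite (@linear_expand _ _ _ _ (fun X => Phi (X :: w))
    (point_block Z i k)) //.
  by move=> a U W; have := Phi_lin a U W [::] w.
rewrite amp_entry_comb; apply: eq_bigr => b _.
by rewrite mul_scalar_mx.
Qed.

(** Compressing Z between block-diagonal matrix units isolates one coordinate
    of every block at once; this bounds [coord_mx] by Z independently of n. *)
Lemma coord_mxE b Z : coord_mx b Z = \sum_(r < s)
  (\mxdiag_(i < n) delta_mx r b.1.2) *m Z b.1.1 *m
  (\mxdiag_(i < n) delta_mx b.2 r).
Proof.
under [RHS]eq_bigr do rewrite mxdiag_sandwich.
rewrite -mxblock_sum; apply/eq_mxblock => i j /=.
rewrite /pt_entry ffunE; set X := submxblock _ i j.
have sandwich r : delta_mx r b.1.2 *m X *m delta_mx b.2 r =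
    X b.1.2 b.2 *: delta_mx r r.
  apply/matrixP => x y; rewrite !mxE (bigD1 b.2) //= big1 ?addr0; last first.
    by move=> z neq_z; rewrite [delta_mx _ _ z _]mxE (negbTE neq_z) mulr0.
  rewrite !mxE (bigD1 b.1.2) //= big1 ?addr0; last first.
    by move=> z neq_z; rewrite mxE (negbTE neq_z) andbF mul0r.
  by rewrite !mxE !eqxx andbT /= mulrAC -natrM mulnb mulrC.
under eq_bigr do rewrite sandwich.
rewrite -scaler_sumr -scalemx1; congr (_ *: _).
by rewrite mx1_sum_delta.
Qed.

Lemma sqbound_coord_mx b Z : (forall k, sqbound (Z k) 1) ->
  sqbound (coord_mx b Z) (coord_const s).
Proof.
move=> Z1; rewrite coord_mxE.
have -> : coord_const s =
    2 ^+ #|'I_s| * #|'I_s|%:R * (block_const s * 1 * block_const s).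
  by rewrite card_ord.
apply: sqbound_sum => r.
have delta_bound p q : sqbound (\mxdiag_(i < n) (delta_mx p q : 'M[R[i]]_s))
      (block_const s).
  apply: sqbound_mxdiag; have := sqbound_mnorm (delta_mx p q : 'M[R[i]]_s).
  by rewrite mnorm_delta expr1n mulr1.
apply: sqboundM => //; first by rewrite mulr1 block_const_ge0.
by apply: sqboundM => //; apply: block_const_ge0.
Qed.

(** Each argument is removed by [amp_cons], at the cost [amp_rate]; fixing the
    first argument to be a matrix unit, which has norm 1, preserves c. *)
Lemma sqbound_amp Phi Zs c : mlin Phi -> bounded_on_words (size Zs) c Phi ->
  {in Zs, forall Z, forall k, sqbound (Z k) 1} ->
  sqbound (amp Phi Zs) (block_const s * c ^+ 2 * amp_rate s g ^+ size Zs).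
Proof.
elim: Zs Phi => [|Z Zs IH] Phi Phi_lin Phi_c Zs1 v /=.
  have -> : amp Phi [::] = \mxdiag_(i < n) Phi [::].
    apply/eq_mxblock => i j /=; case: eqP => // _; exact/esym/conform_mx_id.
  apply: le_trans (sqbound_mxdiag (sqbound_mnorm _) _) _.
  rewrite ler_wpM2r ?sqnorm_ge0 // mulr1 ler_wpM2l ?block_const_ge0 //.
  have := Phi_c [::] erefl; rewrite wnorm_nil mulr1 => le_c.
  by rewrite ler_sqr ?nnegrE ?mnorm_ge0 // (le_trans _ le_c) ?mnorm_ge0.
rewrite amp_cons //.
have step b : sqbound (coord_mx b Z *m amp (fun w => Phi (unit_pt _ b :: w)) Zs)
    (coord_const s * (block_const s * c ^+ 2 * amp_rate s g ^+ size Zs)).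
  apply: sqboundM; first exact: coord_const_ge0.
    by apply: sqbound_coord_mx; apply: Zs1; rewrite mem_head.
  apply: IH => [a U U' A B|w szw|Z' Z'Zs k].
  - exact: (Phi_lin a U U' (unit_pt _ b :: A) B).
  - have := Phi_c (unit_pt _ b :: w).
    by rewrite wnorm_cons pnorm_unit mul1r /= szw; apply.
  - by apply: Zs1; rewrite inE Z'Zs orbT.
apply: le_trans (sqbound_sum step v) _.
rewrite /= [amp_rate s g ^+ _.+1]exprS; move: (_ ^+ size Zs) => x.
by rewrite /amp_rate le_eqVlt; apply/orP; left; apply/eqP; ring.
Qed.

(** A path from i is its first vertex i followed by a path from its second
    vertex, over which the sum is then sorted. *)
Lemma amp_paths Phi l (Zs : l.-tuple bigpt) i j :
  \sum_(k : {ffun 'I_l.+1 -> 'I_n} | (k ord0 == i) && (k ord_max == j))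
    Phi [seq point_block (tnth Zs m) (k (widen_ord (leqnSn l) m))
           (k (lift ord0 m)) | m <- enum 'I_l] = amp_entry Phi Zs i j.
Proof.
elim: l Zs Phi i => [|l IH] Zs Phi i.
  rewrite tuple0 /= enum_ord0 /=.
  have max0 : ord_max = ord0 :> 'I_1 by apply: val_inj.
  case: eqP => [<-|neq_ij]; last first.
    rewrite big_pred0 // => k; rewrite max0.
    by apply/negP=> /andP[/eqP k_i /eqP k_j]; apply: neq_ij; rewrite -k_i.
  rewrite (big_pred1 [ffun=> i]) // => k; rewrite max0 andbb.
  apply/eqP/eqP=> [<-|->]; last by rewrite ffunE.
  by apply/ffunP=> m; rewrite ffunE ord1.
case/tupleP: Zs => Z Zs /=.
under [RHS]eq_bigr do rewrite -IH.
pose tl (k : {ffun 'I_l.+2 -> 'I_n}) := [ffun m => k (lift ord0 m)].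
pose cons_i (k : {ffun 'I_l.+1 -> 'I_n}) : {ffun 'I_l.+2 -> 'I_n} :=
  [ffun m => oapp k i (unlift ord0 m)].
have cons0 k : cons_i k ord0 = i by rewrite ffunE unlift_none.
have consS k m : cons_i k (lift ord0 m) = k m by rewrite ffunE liftK.
rewrite (reindex_onto cons_i tl) => [|k /andP[/eqP k0 _]]; last first.
  apply/ffunP=> m; rewrite ffunE; case: unliftP => [m' ->|->] //=.
  by rewrite ffunE.
have tlK k : tl (cons_i k) = k by apply/ffunP=> m; rewrite ffunE consS.
have max_lift : ord_max = lift ord0 ord_max :> 'I_l.+2 by apply: val_inj.
under eq_bigl do rewrite cons0 tlK !eqxx andbT /= max_lift consS.
rewrite (partition_big (fun k : {ffun 'I_l.+1 -> 'I_n} => k ord0) xpredT) //=.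
apply: eq_bigr => k0 _; apply: eq_big => [k|k /andP[_ /eqP <-]].
  by rewrite andbC.
have widen0 : widen_ord (leqnSn l.+1) ord0 = ord0 by apply: val_inj.
rewrite enum_ordSl /= tnth0 widen0 cons0 consS -map_comp.
congr (Phi (_ :: _)); apply: eq_map => m /=.
rewrite tnthS consS; congr (point_block _ _ _).
rewrite -(consS k); congr (cons_i k _); exact: val_inj.
Qed.

Lemma ampliationE l (T : l.-tuple pt -> 'M[R[i]]_s) Phi
    (Zs : l.-tuple bigpt) : (forall t : l.-tuple pt, T t = Phi t) ->
  ampliation (n := n) T Zs = amp Phi Zs.
Proof.
move=> T_Phi; apply/eq_mxblock => i j; rewrite -amp_paths.
by apply: eq_bigr => k _; rewrite T_Phi.
Qed.

End Ampliations.

(** * Completely bounded norms and the root test *)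

Lemma euclidean_normE m (v : 'cV[R[i]]_m) :
  euclidean_norm v = Num.sqrt (sqnorm v).
Proof. by []. Qed.

Lemma sqnorm_eq0 m (v : 'cV[R[i]]_m) : sqnorm v = 0 -> v = 0.
Proof.
move=> /eqP; rewrite psumr_eq0 => [/allP v0|a _]; last exact: sqr_ge0.
apply/colP => a; rewrite mxE; apply: ComplexField.Normc.eq0_normc.
by have := v0 a (mem_index_enum a); rewrite sqrf_eq0 => /eqP.
Qed.

Lemma normc_real (x : R) : 0 <= x -> normc (x%:C)%C = x.
Proof. by move=> x0; rewrite /= expr0n addr0 sqrtr_sqr ger0_norm. Qed.

(** The supremum defining [opnorm] only bounds the action on unit vectors if it
    is taken over a bounded set, which [sqbound_mnorm] provides. *)
Lemma opnorm_sqbound m (A : 'M[R[i]]_m) : opnorm A <= 1 -> sqbound A 1.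
Proof.
move=> A1 v; rewrite mul1r.
case: (eqVneq (sqnorm v) 0) => [/sqnorm_eq0->|v_neq0].
  by rewrite mulmx0 sqnorm0.
have v_gt0 : 0 < sqnorm v by rewrite lt_neqAle eq_sym v_neq0 sqnorm_ge0.
pose r := Num.sqrt (sqnorm v); have r_gt0 : 0 < r by rewrite sqrtr_gt0.
have r2 : r ^+ 2 = sqnorm v by rewrite sqr_sqrtr ?sqnorm_ge0.
have scaled w : sqnorm ((r^-1)%:C%C *: w) = (sqnorm v)^-1 * sqnorm w.
  by rewrite sqnormZ normc_real ?invr_ge0 ?ltW // exprVn r2.
have u1 : euclidean_norm ((r^-1)%:C%C *: v) = 1.
  by rewrite euclidean_normE scaled mulVf // sqrtr1.
have : euclidean_norm (A *m ((r^-1)%:C%C *: v)) <= 1.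
  apply: le_trans A1; apply: ub_le_sup; last by exists ((r^-1)%:C%C *: v).
  exists (Num.sqrt (2 ^+ m * m%:R * mnorm A ^+ 2)) => _ [w w1 <-].
  rewrite euclidean_normE ler_sqrt; last first.
    by rewrite !mulr_ge0 ?exprn_ge0 ?mnorm_ge0.
  apply: le_trans (sqbound_mnorm A w) _.
  suff -> : sqnorm w = 1 by rewrite mulr1.
  by rewrite -[LHS]sqr_sqrtr ?sqnorm_ge0 // -euclidean_normE w1 expr1n.
rewrite -scalemxAr euclidean_normE scaled -sqrtr1 ler_sqrt ?ler01 //.
by rewrite mulrC ler_pdivrMr // mul1r.
Qed.

Lemma sqbound_opnorm m (A : 'M[R[i]]_m) c : 0 <= c ->
  sqbound A (c ^+ 2) -> opnorm A <= c.
Proof.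
move=> c0 Ac; rewrite /opnorm.
(* There are no unit vectors in dimension 0, where the supremum is 0. *)
have [->|/set0P ne] := eqVneq [set euclidean_norm (A *m v) | v in
    [set v | euclidean_norm v = 1]] set0; first by rewrite sup0.
apply: ge_sup => // _ [v v1 <-]; rewrite euclidean_normE.
rewrite -[leRHS]ger0_norm // -sqrtr_sqr ler_sqrt ?sqr_ge0 //.
apply: le_trans (Ac v) _.
suff -> : sqnorm v = 1 by rewrite mulr1.
by rewrite -[LHS]sqr_sqrtr ?sqnorm_ge0 // -euclidean_normE v1 expr1n.
Qed.

Lemma point_norm_sqbound m g (Z : mxpoint R[i] m g) k :
  point_norm Z = 1 -> sqbound (Z k) 1.
Proof.
move=> Z1; apply: opnorm_sqbound; rewrite -Z1 /point_norm.
exact: le_bigmax.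
Qed.

Lemma cb_norm_bound s g l c Phi
    (T : l.-tuple (mxpoint R[i] s g) -> 'M[R[i]]_s) :
  mlin Phi -> 0 <= c -> bounded_on_words l c Phi -> (forall t, T t = Phi t) ->
  (cb_norm T <=
    ((1 + block_const s) * c * (1 + amp_rate s g) ^+ l)%:E)%E.
Proof.
move=> Phi_lin c0 Phi_c T_Phi.
apply: ge_ereal_sup => _ [n _ <-]; apply: ge_ereal_sup => _ [Zs Zs1 <-].
rewrite lee_fin (ampliationE _ T_Phi).
have d0 := block_const_ge0 s; have E0 := amp_rate_ge0 s g.
apply: sqbound_opnorm => [|v].
  by rewrite !mulr_ge0 ?exprn_ge0 ?addr_ge0.
have Zs_bound Z : Z \in tval Zs -> forall k, sqbound (Z k) 1.
  by move=> /tnthP[m ->] k; apply: point_norm_sqbound.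
have szZs := size_tuple Zs; rewrite -szZs in Phi_c.
apply: le_trans (sqbound_amp Phi_lin Phi_c Zs_bound v) _.
rewrite ler_wpM2r ?sqnorm_ge0 // szZs.
move: (block_const s) (amp_rate s g) d0 E0 => d E d0 E0; rewrite !exprMn.
have square_le (x : R) : 0 <= x -> x <= (1 + x) ^+ 2.
  by move=> x0; rewrite sqrrD expr1n mul1r; nra.
rewrite ler_pM ?mulr_ge0 ?exprn_ge0 //.
  by rewrite ler_wpM2r ?square_le // exprn_ge0.
by rewrite [leRHS]exprAC lerXn2r ?nnegrE ?square_le // exprn_ge0 // addr_ge0.
Qed.

(** Since x_l <= B^l for l >= 1 with B = (1 + C)(1 + Q), every l-th root is at
    most B. *)
Lemma limn_esup_root (x : (\bar R)^nat) (C Q : R) : 0 <= C -> 0 <= Q ->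
  (forall l, x l <= (C * Q ^+ l)%:E)%E ->
  (limn_esup (fun l => poweR (x l) (l%:R^-1)) < +oo)%E.
Proof.
move=> C0 Q0 x_le; pose B := (1 + C) * (1 + Q).
have C1 : 1 <= 1 + C by rewrite lerDl.
have Q1 : 1 <= 1 + Q by rewrite lerDl.
have B1 : 1 <= B by rewrite -[leLHS]mulr1 ler_pM.
have B0 : 0 <= B by apply: le_trans B1.
apply: (@le_lt_trans _ _ B%:E); last exact: ltry.
apply: (@le_trans _ _ (ereal_sup
    ((fun l => poweR (x l) (l%:R^-1)) @` setT))).
  by apply: ereal_inf_lbound; exists setT => //; apply: filterT.
apply: ge_ereal_sup => _ [[_ <-|l _ <-]].
  by rewrite invr0 poweRe0 lee_fin.
have := x_le l.+1; case: (x l.+1) => [r||] //=.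
  rewrite !lee_fin => le_r.
  (* The real power of a negative number is 1 by convention. *)
  case: (ltP 0 r) => [r0|r_le0]; last first.
    rewrite /powR; case: eqP => _; last by rewrite ln0 // mulr0 expR0.
    by apply: le_trans B1; case: eqP.
  have le_B : r <= B ^+ l.+1.
    apply: le_trans le_r _; rewrite exprMn ler_pM ?exprn_ge0 //.
      by apply: (@le_trans _ _ (1 + C)); rewrite ?lerDr // exprS ler_peMr
        ?exprn_ege1 // (le_trans _ C1).
    by rewrite lerXn2r ?nnegrE ?lerDr // (le_trans _ Q1).
  have -> : B = (B ^+ l.+1) `^ l.+1%:R^-1.
    by rewrite -powR_mulrn // -powRrM mulfV ?pnatr_eq0 // powRr1.
  by apply: ge0_ler_powR; rewrite ?nnegrE ?exprn_ge0 ?invr_ge0 // ltW.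
by move=> _; case: eqP => _; rewrite lee_fin.
Qed.

End SquareNorm.

(** * The propagation theorem *)

Theorem theorem7p2 :
  (forall (F : fieldType) (s g : nat) (Y : mxpoint F s g)
      (pi : {linear mxpoint F s g -> mxpoint F s g}) (L : nat) (f : mapseq F s g),
    [pchar F] =i pred0 ->
    semisimple_point Y ->
    bimodule_projection Y pi ->
    IC_trunc Y L f ->
    exists h : mapseq F s g,
      propagation Y pi L f h /\
      forall h' : mapseq F s g, propagation Y pi L f h' ->
        forall l (t : l.-tuple (mxpoint F s g)), h' l t = h l t)
  /\
  (forall (R : realType) (s g : nat) (Y : mxpoint R[i] s g)
      (pi : {linear mxpoint R[i] s g -> mxpoint R[i] s g}) (L : nat)
      (f h : mapseq R[i] s g),
    semisimple_point Y ->
    bimodule_projection Y pi ->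
    IC_trunc Y L f ->
    propagation Y pi L f h ->
    (limn_esup (fun l => poweR (cb_norm (h l)) (l%:R^-1)) < +oo)%E).
Proof.
split=> [F s g Y pi L f _ _ pi_proj f_ic|R s g Y pi L f h _ pi_proj _ prop].
  have [h h_prop] := propagation_exists pi_proj f_ic.
  exists h; split=> // h'; exact: propagation_unique.
have [_ /ICP[h_lin h_rel] h_ker] := prop.
have [p p_ge0 pi_bound] := linear_pnorm_bound pi.
have [k k_ge0 brk_bound] := brk_preimage_bound pi_proj.
have [|c [K [c_ge0 K_ge0 h_bound]]] := word_growth pi_proj p_ge0 k_ge0
  pi_bound brk_bound h_lin h_rel (L := L).
  move=> w lt_Lw /allP ker_w; apply: h_ker => // i.
  by apply/eqP/ker_w/mem_tnth.
apply: (@limn_esup_root _ _ ((1 + block_const R s) * c)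
  (K * (1 + amp_rate R s g))) => [||l].
- by rewrite mulr_ge0 ?addr_ge0 ?block_const_ge0.
- by rewrite mulr_ge0 ?addr_ge0 ?amp_rate_ge0.
- have := @cb_norm_bound _ _ _ l (c * K ^+ l) (word_fun h) (h l) h_lin.
  rewrite exprMn !mulrA; apply=> //; first by rewrite mulr_ge0 ?exprn_ge0.
  by move=> t; rewrite word_funE.
Qed.
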